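(* Let $n\geqslant 1$ be an integer, let $c,H>0$ and let $b,m^2\geqslant 0$ be such that $b^2\geqslant 4m^2$. Assume $\beta\geqslant 0$ and $p>1$ are such that $$\frac n2-\frac{\sqrt{b^2-4m^2}}{2H}\leqslant\frac1p,$$ and set $$\varrho_{\mathrm{crit}}(n,H,b,m^2,\beta,p)=\tfrac12\left(b-\sqrt{b^2-4m^2}\right)\left((\beta+1)p-1\right)+nH(\beta+1)(p-1),$$ $$\kappa_{\mathrm{crit}}(b,m^2,\beta,p)=\begin{cases}-1 & \text{if } b^2>4m^2,\\ -1-(\beta+1)p & \text{if } b^2=4m^2.\end{cases}$$ Consider $\Gamma(t)=\mu\,\mathrm{e}^{\varrho_{\mathrm{crit}}(n,H,b,m^2,\beta,p)t}(1+t)^{\kappa_{\mathrm{crit}}(b,m^2,\beta,p)}$ for some $\mu>0$ in the nonlinear term $$f(t,v)=\Gamma(t)\left(\int_{\mathbb{R}^n}|v(t,y)|^p\,\mathrm{d}y\right)^{\beta}|v|^p .$$ Let $v_0,v_1\in L^1_{\mathrm{loc}}(\mathbb{R}^n)$ be nonnegative, nontrivial and compactly supported functions with supports contained in $B_R$ for some $R>0$. Let $v\in\mathcal{C}^1([0,T),L^1_{\mathrm{loc}}(\mathbb{R}^n))$ be a weak solution (in the sense defined in the context) to the Cauchy problem $$\begin{cases}\partial_t^2v-c^2\mathrm{e}^{2Ht}\Delta v+b\,\partial_tv+m^2v=f(t,v), & x\in\mathbb{R}^n,\ t\in(0,T),\\ v(0,x)=\varepsilon v_0(x), & x\in\mathbb{R}^n,\\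 \partial_tv(0,x)=\varepsilon v_1(x), & x\in\mathbb{R}^n,\end{cases}$$ with lifespan $T=T(\varepsilon)$. Then there exists a positive constant $\varepsilon_0=\varepsilon_0(n,c,H,b,m^2,\beta,p,\mu,v_0,v_1,R)$ such that for any $\varepsilon\in(0,\varepsilon_0]$ the weak solution $v$ blows up in finite time. Furthermore, the following upper bound estimate for the lifespan holds: $$T(\varepsilon)\leqslant C\exp\left(K\varepsilon^{-\left((\beta+1)p-1\right)}\right),$$ where the positive constants $C,K$ are independent of $\varepsilon$.
   Context: Here $\varepsilon>0$ is a parameter describing the size of the initial data, $B_\rho=\{x\in\mathbb{R}^n:|x|\leqslant\rho\}$, and $T=T(\varepsilon)\in(0,\infty]$ denotes the lifespan, i.e. the maximal existence time, of the weak solution; blow-up in finite time means $T(\varepsilon)<\infty$. Definition (weak solution). Let $v_0,v_1\in L^1_{\mathrm{loc}}(\mathbb{R}^n)$ with $\operatorname{supp}v_0,\operatorname{supp}v_1\subset B_R$ for some $R>0$. A function $v\in\mathcal{C}^1([0,T),L^1_{\mathrm{loc}}(\mathbb{R}^n))$ such that $f(t,v)\in L^1_{\mathrm{loc}}((0,T)\times\mathbb{R}^n)$ is a weak solution to the Cauchy problem on $[0,T)$ if $\operatorname{supp}v(t,\cdot)\subset B_{R+cH^{-1}(\mathrm{e}^{Ht}-1)}$ for any $t\in(0,T)$ and the integral identity $$\begin{aligned}&\int_{\mathbb{R}^n}\partial_tv(t,x)\varphi(t,x)\,\mathrm{d}x-\int_{\mathbb{R}^n}v(t,x)\varphi_t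(t,x)\,\mathrm{d}x+b\int_{\mathbb{R}^n}v(t,x)\varphi(t,x)\,\mathrm{d}x\\&\quad+\int_0^t\int_{\mathbb{R}^n}v(s,x)\left(\varphi_{ss}(s,x)-c^2\mathrm{e}^{2Hs}\Delta\varphi(s,x)-b\,\varphi_s(s,x)+m^2\varphi(s,x)\right)\mathrm{d}x\,\mathrm{d}s\\&=\varepsilon\int_{\mathbb{R}^n}v_1(x)\varphi(0,x)\,\mathrm{d}x+\varepsilon\int_{\mathbb{R}^n}v_0(x)\left(b\,\varphi(0,x)-\varphi_t(0,x)\right)\mathrm{d}x\\&\quad+\int_0^t\Gamma(s)\left(\int_{\mathbb{R}^n}|v(s,y)|^p\,\mathrm{d}y\right)^{\beta}\int_{\mathbb{R}^n}|v(s,x)|^p\varphi(s,x)\,\mathrm{d}x\,\mathrm{d}s\end{aligned}$$ holds for any $t\in(0,T)$ and any test function $\varphi\in\mathcal{C}^\infty_0([0,T)\times\mathbb{R}^n)$. *)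

(* Defs.v *)
From HB Require Import structures.
From mathcomp Require Import all_boot all_order all_algebra.
From mathcomp Require Import all_classical all_reals all_analysis.
From mathcomp Require Import measurable_realfun.

Set Implicit Arguments.
Unset Strict Implicit.
Unset Printing Implicit Defensive.

Import Order.TTheory GRing.Theory Num.Theory.
Import numFieldNormedType.Exports.

Local Open Scope classical_set_scope.
Local Open Scope ring_scope.
Local Open Scope ereal_scope.

Section measurable_rV.
Context {R : realType} (n : nat).

Let coord : 'I_n -> 'rV[R]_n -> R := fun i x => x ord0 i.

Let rV_set0 : g_sigma_preimage coord set0.
Proof. exact: sigma_algebra0. Qed.

Let rV_setC A : g_sigma_preimage coord A -> g_sigma_preimage coord (~` A).
Proof. exact: sigma_algebraC. Qed.

Let rV_bigcup (F : (set 'rV[R]_n)^nat) :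
  (forall i, g_sigma_preimage coord (F i)) ->
  g_sigma_preimage coord (\bigcup_i (F i)).
Proof. exact: sigma_algebra_bigcup. Qed.

HB.instance Definition _ :=
  @isMeasurable.Build (measure_tuple_display default_measure_display)
    'rV[R]_n (g_sigma_preimage coord) rV_set0 rV_setC rV_bigcup.

Lemma measurable_coord_rV (i : 'I_n) :
  measurable_fun [set: 'rV[R]_n] (fun x : 'rV[R]_n => x ord0 i : R).
Proof.
move=> _ Y mY; rewrite setTI; apply: sub_sigma_algebra => /=.
rewrite -bigcup_seq/=; exists i => /=; first by rewrite mem_index_enum.
by exists Y => //; rewrite setTI.
Qed.

Lemma measurable_fun_rV d (T : measurableType d) (f : T -> 'rV[R]_n) :
  (forall i, measurable_fun [set: T] (fun t => f t ord0 i : R)) ->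
  measurable_fun [set: T] f.
Proof.
move=> mf; apply: (@measurability _ _ _ _ [set: T] f
  (\big[setU/set0]_(i < n) preimage_set_system setT (coord i) measurable)) => //.
move=> _ [B + <-]; rewrite -bigcup_seq => -[i _ [A mA <-]].
by rewrite setTI; have := mf i measurableT A mA; rewrite !setTI.
Qed.

End measurable_rV.

(* Lebesgue measure on R^n: the n-fold product of [lebesgue_measure],
   transported along (a, y) |-> the row vector a :: y. *)
Fixpoint lebesgue_rV {R : realType} (n : nat) : set 'rV[R]_n -> \bar R :=
  match n with
  | 0 => \d_(0%R : 'rV[R]_0)
  | n'.+1 => pushforward (lebesgue_measure \x lebesgue_rV (n := n'))
      (fun z : measurableTypeR R * 'rV[R]_n' =>
         row_mx (z.1 : R)%:M z.2 : 'rV[R]_n'.+1)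
  end.


Section lebesgue_rV_measure.
Context {R : realType}.

Let cons_rV n (z : measurableTypeR R * 'rV[R]_n) : 'rV[R]_n.+1 :=
  row_mx (z.1 : R)%:M z.2.

Let measurable_cons_rV n : measurable_fun setT (@cons_rV n).
Proof.
apply: measurable_fun_rV => i; rewrite /cons_rV.
case: (@split_ordP 1 n i) => j ->.
- rewrite (_ : (fun _ => _) = fst); first exact: measurable_fst.
  by apply/funext => z; rewrite [LHS]row_mxEl (ord1 j) mxE eqxx mulr1n.
- rewrite (_ : (fun _ => _) = fun z : measurableTypeR R * 'rV[R]_n => z.2 ord0 j : R).
    exact: measurableT_comp (measurable_coord_rV j) measurable_snd.
  by apply/funext => z; rewrite [LHS]row_mxEr.
Qed.

Let uncons_rV n (x : 'rV[R]_n.+1) : measurableTypeR R * 'rV[R]_n :=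
  (x ord0 ord0, @rsubmx _ 1 1 n x).

Let measurable_uncons_rV n : measurable_fun setT (@uncons_rV n).
Proof.
apply: measurable_fun_pair; first exact: measurable_coord_rV.
apply: measurable_fun_rV => i; under eq_fun do rewrite mxE.
exact: measurable_coord_rV.
Qed.

Let cons_rVK n : cancel (@cons_rV n) (@uncons_rV n).
Proof.
case=> a y; rewrite /uncons_rV /cons_rV /= row_mxKr; congr pair.
have -> : ord0 = lshift n ord0 :> 'I_(1 + n) by exact/val_inj.
by rewrite [LHS]row_mxEl mxE eqxx mulr1n.
Qed.

Let lebesgue_rV_ex n : exists mu : {sigma_finite_measure set 'rV[R]_n -> \bar R},
  forall A, lebesgue_rV A = mu A.
Proof.
elim: n => [|n [mu muE]]; first by exists (\d_(0%R : 'rV[R]_0)).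
pose nu : set 'rV[R]_n.+1 -> \bar R :=
  pushforward (lebesgue_measure \x mu) (@cons_rV n).
have nu0 : nu set0 = 0 by rewrite /nu /pushforward preimage_set0 measure0.
have mpre A : measurable A -> measurable (@cons_rV n @^-1` A).
  by move=> mA; rewrite -[X in measurable X]setTI; exact: measurable_cons_rV.
have nu_ge0 A : 0 <= nu A by rewrite /nu /pushforward; exact: measure_ge0.
have nu_sigma : semi_sigma_additive nu.
  move=> F mF tF mUF; rewrite /nu /pushforward preimage_bigcup.
  apply: measure_semi_sigma_additive.
  - by move=> k; exact: mpre.
  - apply/trivIsetP => /= i j _ _ ij; rewrite -preimage_setI.
    by move/trivIsetP : tF => /(_ _ _ _ _ ij) ->//; rewrite preimage_set0.
  - by rewrite -preimage_bigcup; exact: mpre.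
pose nuM := isMeasure.Build _ _ _ nu nu0 nu_ge0 nu_sigma.
pose nu' : {measure set 'rV[R]_n.+1 -> \bar R} := HB.pack nu nuM.
have nu_sf : sigma_finite setT nu.
  have [F FT Foo] : sigma_finite setT (lebesgue_measure \x mu).
    have /sigma_finiteP[F [TF ndF Foo]] := sigma_finiteT (@lebesgue_measure R).
    have /sigma_finiteP[G [TG ndG Goo]] := sigma_finiteT mu.
    exists (fun k => F k `*` G k).
      rewrite -setXTT TF TG predeqE => -[x y]; split.
        move=> [/= [k _ Fkx] [l _ Gly]]; exists (maxn k l) => //; split.
        - by move: x Fkx; exact/subsetPset/ndF/leq_maxl.
        - by move: y Gly; exact/subsetPset/ndG/leq_maxr.
      by move=> [k _ []/= ? ?]; split; exists k.
    move=> k; have [? ?] := Foo k; have [? ?] := Goo k.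
    split; first exact: measurableX.
    by rewrite product_measure1E// lte_mul_pinfty// ge0_fin_numE.
  exists (fun k => @uncons_rV n @^-1` F k).
    by rewrite -preimage_bigcup -FT preimage_setT.
  move=> k; have [mF Fk] := Foo k; split.
    by rewrite -[X in measurable X]setTI; exact: measurable_uncons_rV.
  rewrite /nu /pushforward -comp_preimage.
  rewrite (_ : _ \o _ = id) ?preimage_id//.
  by apply/funext => z /=; rewrite cons_rVK.
pose nuS := Measure_isSigmaFinite.Build _ _ _ nu' nu_sf.
pose nu'' : {sigma_finite_measure set 'rV[R]_n.+1 -> \bar R} :=
  HB.pack nu nuM nuS.
exists nu'' => A; rewrite /= /nu.
by rewrite (_ : @lebesgue_rV R n = mu)//; exact/funext.
Qed.

Let lebesgue_rV0 n : lebesgue_rV (@set0 'rV[R]_n) = 0.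
Proof. by have [mu ->] := lebesgue_rV_ex n; rewrite measure0. Qed.

Let lebesgue_rV_ge0 n (A : set 'rV[R]_n) : 0 <= lebesgue_rV A.
Proof. by have [mu ->] := lebesgue_rV_ex n. Qed.

Let lebesgue_rV_sigma_additive n :
  semi_sigma_additive (@lebesgue_rV R n).
Proof.
have [mu muE] := lebesgue_rV_ex n.
have -> : @lebesgue_rV R n = mu by exact/funext.
exact: measure_semi_sigma_additive.
Qed.

HB.instance Definition _ n := isMeasure.Build _ _ _ (@lebesgue_rV R n)
  (@lebesgue_rV0 n) (@lebesgue_rV_ge0 n) (@lebesgue_rV_sigma_additive n).

Let lebesgue_rV_sigma_finite n : sigma_finite setT (@lebesgue_rV R n).
Proof.
have [mu muE] := lebesgue_rV_ex n.
have -> : @lebesgue_rV R n = mu by exact/funext.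
exact: sigma_finiteT.
Qed.

HB.instance Definition _ n := Measure_isSigmaFinite.Build _ _ _
  (@lebesgue_rV R n) (@lebesgue_rV_sigma_finite n).

End lebesgue_rV_measure.

Definition enorm {R : realType} n (x : 'rV[R]_n) : R :=
  Num.sqrt (\sum_(i < n) x ord0 i ^+ 2)%R.

(* The closed Euclidean ball; the norm of the normed module 'rV[R]_n is the
   sup norm, whence [enorm]. *)
Definition eball {R : realType} n (r : R) : set 'rV[R]_n :=
  [set x | (enorm x <= r)%R].

(* Support of a function regarded up to almost-everywhere equality: the
   complement of the largest open set on which it vanishes a.e. *)
Definition ess_supp {R : realType} n (f : 'rV[R]_n -> R) : set 'rV[R]_n :=
  [set x | forall U, nbhs x U ->
     ~ {ae @lebesgue_rV R n, forall y, U y -> f y = 0%R}].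

Definition L1loc {R : realType} n (f : 'rV[R]_n -> R) :=
  measurable_fun setT f /\
  forall K, compact K -> \int[@lebesgue_rV R n]_(x in K) `|f x|%:E < +oo.

Definition spacetime {R : realType} n (T : \bar R) : set (R * 'rV[R]_n) :=
  [set z | (0 < z.1)%R /\ z.1%:E < T].

(* L^1_loc of (0,T) x R^n. The function is extended-real valued because a
   nonlocal nonlinearity need not be finite everywhere. *)
Definition L1loc_spacetime {R : realType} n (T : \bar R)
    (F : R -> 'rV[R]_n -> \bar R) :=
  measurable_fun (spacetime T) (fun z : R * 'rV[R]_n => F z.1 z.2) /\
  forall K : set (R * 'rV[R]_n), compact K -> K `<=` spacetime T ->
    \int[lebesgue_measure \x @lebesgue_rV R n]_(z in K) `|F z.1 z.2| < +oo.

(* v belongs to C^1([0,T), L^1_loc(R^n)) with derivative dv, where L^1_loc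
   carries the seminorms of L^1(K), K compact; the difference quotient at
   t = 0 is one-sided. *)
Definition C1_L1loc {R : realType} n (T : \bar R)
    (v dv : R -> 'rV[R]_n -> R) :=
  forall t : R, (0 <= t)%R -> t%:E < T ->
  [/\ L1loc (v t), L1loc (dv t) &
   forall K, compact K ->
     (fun h => \int[@lebesgue_rV R n]_(x in K)
                 `| (v (t + h) x - v t x) / h - dv t x |%:E)
       @ within [set h | (0 <= t + h)%R] (0%R : R)^' --> 0 /\
     (fun s => \int[@lebesgue_rV R n]_(x in K) `| dv s x - dv t x |%:E)
       @ within [set s | (0 <= s)%R] (nbhs t) --> 0].

Fixpoint Ck {R : realType} (V : normedModType R) (k : nat) (f : V -> R) :=
  match k with
  | 0 => continuous f
  | k'.+1 => forall v, (forall x, derivable f x v) /\ Ck k' ('D_v f)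
  end.

Definition smooth {R : realType} (V : normedModType R) (f : V -> R) :=
  forall k, Ck k f.

Definition dt {R : realType} n (phi : R * 'rV[R]_n -> R) :
    R * 'rV[R]_n -> R :=
  'D_((1%R, 0%R) : R * 'rV[R]_n) phi.

Definition dx {R : realType} n (i : 'I_n) (phi : R * 'rV[R]_n -> R) :
    R * 'rV[R]_n -> R :=
  'D_((0%R, delta_mx ord0 i) : R * 'rV[R]_n) phi.

Definition laplacian {R : realType} n (phi : R * 'rV[R]_n -> R) :
    R * 'rV[R]_n -> R :=
  fun z => (\sum_(i < n) dx i (dx i phi) z)%R.

(* C_0^oo([0,T) x R^n). An element is represented by a smooth extension to
   R x R^n, whose values at times outside [0,T) are irrelevant. *)
Definition test_function {R : realType} n (T : \bar R)
    (phi : R * 'rV[R]_n -> R) :=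
  smooth phi /\
  exists K : set (R * 'rV[R]_n),
    [/\ compact K, K `<=` [set z | (0 <= z.1)%R /\ z.1%:E < T] &
        forall z, (0 <= z.1)%R -> z.1%:E < T -> ~ K z -> phi z = 0%R].

(* f(t,v)(x) for u = v(t,.); [poweR] satisfies y `^ 0 = 1 for every y. *)
Definition nonlinearity {R : realType} n (Gamma : R -> R) (beta p : R) (t : R)
    (u : 'rV[R]_n -> R) (x : 'rV[R]_n) : \bar R :=
  (Gamma t)%:E *
  poweR (\int[@lebesgue_rV R n]_y (`|u y| `^ p)%:E) beta *
  (`|u x| `^ p)%:E.

(* The radius c (e^(Ht) - 1) / H of the light cone of a point. *)
Definition light_cone {R : realType} (c H t : R) : R :=
  (c / H * (expR (H * t) - 1))%R.

Definition integral_identity {R : realType} n (c H b m2 beta p : R)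
    (Gamma : R -> R) (eps : R) (v0 v1 : 'rV[R]_n -> R)
    (v dv : R -> 'rV[R]_n -> R) (phi : R * 'rV[R]_n -> R) (t : R) :=
  let mu := @lebesgue_rV R n in
  \int[mu]_x (dv t x * phi (t, x))%:E
  - \int[mu]_x (v t x * dt phi (t, x))%:E
  + b%:E * \int[mu]_x (v t x * phi (t, x))%:E
  + \int[lebesgue_measure]_(s in `[0%R, t]) \int[mu]_x
      (v s x * (dt (dt phi) (s, x)
                - c ^+ 2 * expR (2 * H * s) * laplacian phi (s, x)
                - b * dt phi (s, x) + m2 * phi (s, x)))%:E
  = eps%:E * \int[mu]_x (v1 x * phi (0%R, x))%:E
  + eps%:E * \int[mu]_x (v0 x * (b * phi (0%R, x) - dt phi (0%R, x)))%:E
  + \int[lebesgue_measure]_(s in `[0%R, t])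
      ((Gamma s)%:E * poweR (\int[mu]_y (`|v s y| `^ p)%:E) beta *
       \int[mu]_x (`|v s x| `^ p * phi (s, x))%:E).

Definition weak_solution {R : realType} n (c H b m2 beta p : R)
    (Gamma : R -> R) (eps Rad : R) (v0 v1 : 'rV[R]_n -> R)
    (T : \bar R) (v : R -> 'rV[R]_n -> R) :=
  exists dv : R -> 'rV[R]_n -> R,
  [/\ C1_L1loc T v dv,
      L1loc_spacetime T
        (fun t x => nonlinearity Gamma beta p t (v t) x),
      forall t : R, (0 < t)%R -> t%:E < T ->
        ess_supp (v t) `<=` eball (Rad + light_cone c H t)%R &
      forall t : R, (0 < t)%R -> t%:E < T ->
        forall phi, test_function T phi ->
        integral_identity c H b m2 beta p Gamma eps v0 v1 v dv phi t].

(* The maximal existence time of a weak solution v on [0,T): the supremum of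
   the T' such that v extends to a weak solution on [0,T'). *)
Definition lifespan {R : realType} n (c H b m2 beta p : R)
    (Gamma : R -> R) (eps Rad : R) (v0 v1 : 'rV[R]_n -> R)
    (T : \bar R) (v : R -> 'rV[R]_n -> R) : \bar R :=
  ereal_sup [set T' | T <= T' /\
    exists w, weak_solution c H b m2 beta p Gamma eps Rad v0 v1 T' w /\
      forall t : R, (0 <= t)%R -> t%:E < T ->
        {ae @lebesgue_rV R n, forall x, w t x = v t x}].

Definition rho_crit {R : realType} (n : nat) (H b m2 beta p : R) : R :=
  (2^-1 * (b - Num.sqrt (b ^+ 2 - 4 * m2)) * ((beta + 1) * p - 1)
   + n%:R * H * (beta + 1) * (p - 1))%R.

Definition kappa_crit {R : realType} (b m2 beta p : R) : R :=
  (if 4 * m2 < b ^+ 2 then - 1 else - 1 - (beta + 1) * p)%R.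

Definition Gamma_crit {R : realType} (n : nat) (H b m2 beta p mu : R) (t : R)
    : R :=
  (mu * expR (rho_crit n H b m2 beta p * t)
   * (1 + t) `^ kappa_crit b m2 beta p)%R.

(* Main.v *)
From HB Require Import structures.
Require Import Defs.
From mathcomp Require Import all_boot all_order all_algebra.
From mathcomp Require Import all_classical all_reals all_analysis.
From mathcomp Require Import measurable_realfun.
From mathcomp Require Import ring lra.
Import Order.TTheory GRing.Theory Num.Theory.
Import numFieldNormedType.Exports.
Local Open Scope classical_set_scope.
Local Open Scope ring_scope.

(** Let [m(t)] be the integral of [v(t, .)] over space, [d = sqrt (b^2 - 4 m2)],
    [a = (b - d) / 2] and [q = (beta + 1) p]. By finite propagation speed, a
    compactly supported test function that is constant in space on the light cone
    acts like a function of time alone, so [m] formally solves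
    [m'' + b m' + m2 m = N], with [N] the integral of the nonlinearity. The time
    derivative of [v] is avoided by testing with [k (t - s)], where [k] is the
    fundamental solution of this ODE; the identity then becomes the variation of
    constants formula, and only [m(t)] survives on its linear side ([duhamel_mass]).

    The section of the light cone at time [s] has volume of order [e^(n H s)], whence
    [int |v|^p >= C m^p e^(- n H (p - 1) s)] ([power_integral_lower_bound]). After
    the decay [e^(- a s)] of the homogeneous solutions is factored out, together
    with their growth [w s], which is 1 for distinct characteristic roots and
    [1 + s] for a double root, the quantity [Y t = e^(a t) m(t) / w t] satisfies
    [Y >= I eps] and
    [Y t >= C int_0^t k0 (t - s) / w t * Y(s)^q / (1 + s) ds] with
    [k0 s = e^(a s) k s]. The critical exponents are those which produce the
    borderline weight [1 / (1 + s)] ([critical_balance]).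

    In the variable [x = ln (1 + t)] this inequality says that a lower bound [M] valid
    from [x] on improves to [C delta M^q (y - delta - x)] at every [y >= x + delta].
    Multiplying [M] by a constant in each round, with geometrically decreasing
    [delta] and waiting times, accumulates infinitely many rounds within a span of
    order [1 + (I eps)^(1 - q)] of [x] ([log_time_bound]). A finite [m(t)] cannot
    exceed all these bounds, so [ln (1 + t) <= 2 + K eps^(1 - q)] for every time [t] at
    which a weak solution exists ([critical_log_time]). *)

(** * Smooth cut-off functions *)

(** The index makes the family stable under differentiation, see
    [is_derive_flat]. *)
Definition flat {R : realType} (n : nat) (x : R) : R :=
  if 0 < x then x ^- n * expR (- x^-1) else 0.

Lemma flat_ge0 {R : realType} n (x : R) : 0 <= flat n x.
Proof.
rewrite /flat; case: ifPn => // x0.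
by rewrite mulr_ge0 ?expR_ge0// invr_ge0 exprn_ge0// ltW.
Qed.

(** The exponential beats every power; a quadratic bound is what
    differentiability at 0 needs. *)
Lemma flat_quadratic {R : realType} n (x : R) :
  flat n x <= (n.+2)`!%:R * x ^+ 2.
Proof.
rewrite /flat; case: ifPn => [x0|_]; last first.
  by rewrite mulr_ge0 ?ler0n ?sqr_ge0.
have f0 : 0 < (n.+2)`!%:R :> R by rewrite ltr0n fact_gt0.
have := @expR_ge1Dxn R x^-1 n.+1; rewrite invr_ge0 => /(_ (ltW x0)) e.
have {e} : x ^- n.+2 / (n.+2)`!%:R <= expR x^-1.
  by rewrite -exprVn; apply: le_trans e; rewrite lerDr.
rewrite ler_pdivrMr// expRN => e.
rewrite ler_pdivrMr ?expR_gt0// mulrAC.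
have x2 : 0 < x ^+ 2 by rewrite exprn_gt0.
rewrite -ler_pdivrMr// mulrC -invfM -exprD add2n mulrC.
by rewrite mulrC (le_trans e)// mulrC.
Qed.

Lemma is_derive_flat {R : realType} n (x : R) :
  is_derive x 1 (flat n) (flat n.+2 x - n%:R * flat n.+1 x).
Proof.
have [x0|x0|->] := ltgtP x 0.
- have -> : flat n.+2 x - n%:R * flat n.+1 x = 0.
    by rewrite /flat ltNge ltW//= mulr0 subr0.
  apply: near_eq_is_derive (is_derive_cst (0:R) x 1).
  near=> y; rewrite /flat ltNge ltW//=.
  by near: y; exact: lt_nbhsl.
- pose g (y : R) := y ^- n * expR (- y^-1).
  apply: (@near_eq_is_derive _ _ _ g).
    near=> y; rewrite /flat /g ifT//.
    by near: y; exact: lt_nbhsr.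
  have x0' : x != 0 by rewrite gt_eqF.
  rewrite /flat x0 /g.
  have dV : is_derive x 1 (fun y : R => y^-1) (- x ^- 2).
    by have /is_derive_eq := is_deriveV x0' (is_derive_id x 1); apply; exact: mulr1.
  have dE : is_derive x 1 (fun y : R => expR (- y^-1)) (x ^- 2 * expR (- x^-1)).
    have := @is_derive1_comp R expR (fun y => - y^-1) x _ _ (is_derive_expR _)
      (is_deriveN dV).
    by move=> /is_derive_eq; apply; rewrite opprK mulrC.
  have dP : is_derive x 1 (fun y : R => y ^- n) (- (n%:R * x ^- n.+1)).
    have -> : (fun y : R => y ^- n) = (fun y : R => y^-1) ^+ n.
      by apply/funext => y; rewrite exprfctE exprVn.
    have := is_deriveX n dV; move=> /is_derive_eq; apply.
    rewrite /GRing.scale/=; case: n {g} => [|n]; first by rewrite !mul0r oppr0.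
    by rewrite /= mulrN -mulrA exprVn -invfM -exprD addn2.
  have := is_deriveM dP dE => /is_derive_eq; apply.
  have -> : x ^- n.+2 = x ^- n * x ^- 2 by rewrite -invfM -exprD addn2.
  by rewrite /GRing.scale/=; ring.
(* At 0, the difference quotient is O(h) by [flat_quadratic]. *)
- have -> : flat n.+2 (0:R) - n%:R * flat n.+1 0 = 0.
    by rewrite /flat ltxx mulr0 subr0.
  have C : (fun h : R => h^-1 *: ((flat n \o shift 0) (h *: 1) - flat n 0))
             @ 0^' --> (0 : R).
    apply/cvgrPdist_le => e e0; near=> h; rewrite /= addr0 [_%:A]mulr1 sub0r normrN.
    have h0 : h != 0 by near: h; exact: nbhs_dnbhs_neq.
    rewrite [X in _ - X]/flat ltxx subr0 /GRing.scale/= normrM normfV.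
    have h0' : 0 < `|h| by rewrite normr_gt0.
    rewrite mulrC ler_pdivrMr// ger0_norm ?flat_ge0//.
    rewrite (le_trans (flat_quadratic _ _))// -(real_normK (num_real h)).
    rewrite expr2 mulrA ler_pM2r//.
    have f0 : 0 < (n.+2)`!%:R :> R by rewrite ltr0n fact_gt0.
    rewrite mulrC -ler_pdivlMr//; apply: ltW.
    near: h; apply: dnbhs0_lt; by rewrite divr_gt0.
  split; first by apply/cvg_ex; exists 0.
  exact/cvg_lim.
Unshelve. all: by end_near.
Qed.

(** Smoothness of a product or a composite is awkward to prove by induction on the
    order of differentiation. This class contains the test functions of interest
    and is stable under directional derivatives, so differentiability of its members
    is all that smoothness requires ([elementary_smooth]). *)
Inductive elementary {R : realType} {V : normedModType R} : (V -> R) -> Prop :=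
| elementary_cst a : elementary (fun=> a)
| elementary_linear (l : V -> R^o) : linear l -> continuous l -> elementary l
| elementary_add f g : elementary f -> elementary g ->
    elementary (fun x => f x + g x)
| elementary_mul f g : elementary f -> elementary g ->
    elementary (fun x => f x * g x)
| elementary_exp f : elementary f -> elementary (fun x => expR (f x))
| elementary_flat n f : elementary f -> elementary (fun x => flat n (f x)).

Lemma derive_comp1 {R : realType} {V : normedModType R} (g : R -> R)
    (f : V -> R) (x v : V) dg : differentiable f x ->
  is_derive (f x) 1 g dg ->
  differentiable (fun y => g (f y)) x /\
  'D_v (fun y => g (f y)) x = dg * 'D_v f x.
Proof.
move=> df [dg1 dgE].
have dg' : differentiable g (f x) by exact/derivable1_diffP.
split; first exact: (differentiable_comp df dg').
rewrite (deriveE v (differentiable_comp df dg')) (deriveE v df) diff_comp//=.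
by rewrite deriv1E// derive1E dgE [LHS]mulrC.
Qed.

Lemma elementary_differentiable {R : realType} {V : normedModType R}
    (f : V -> R) (ef : elementary f) x : differentiable f x.
Proof.
elim: ef x => {f}.
- by move=> a x; exact: differentiable_cst.
- move=> l ll cl x.
  pose L : {linear V -> R^o} := HB.pack l (GRing.isLinear.Build R V R^o *:%R l ll).
  exact: (@linear_differentiable _ _ _ L).
- by move=> f g _ df _ dg x; exact: differentiableD.
- by move=> f g _ df _ dg x; exact: differentiableM.
- by move=> f _ df x; have [] := derive_comp1 _ _ x 0 _ (df x) (is_derive_expR (f x)).
- by move=> n f _ df x; have [] := derive_comp1 _ _ x 0 _ (df x) (is_derive_flat n (f x)).
Qed.

Lemma elementary_derive {R : realType} {V : normedModType R} (v : V)
    (f : V -> R) (ef : elementary f) : elementary ('D_v f).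
Proof.
have D := @elementary_differentiable R V.
elim: ef => {f}.
- move=> a; rewrite (_ : 'D_v _ = fun=> 0); first exact: elementary_cst.
  by apply/funext => x; exact: derive_cst.
- move=> l ll cl; rewrite (_ : 'D_v _ = fun=> l v); first exact: elementary_cst.
  pose L : {linear V -> R^o} := HB.pack l (GRing.isLinear.Build R V R^o *:%R l ll).
  apply/funext => x; rewrite (deriveE v (@linear_differentiable _ _ _ L x cl)).
  by rewrite (@diff_lin _ _ _ L x cl).
- move=> f g ef e'f eg e'g.
  rewrite (_ : 'D_v _ = fun x => 'D_v f x + 'D_v g x); first exact: elementary_add.
  by apply/funext => x; rewrite deriveD//; apply: diff_derivable; exact: D.
- move=> f g ef e'f eg e'g.
  rewrite (_ : 'D_v _ = fun x => f x * 'D_v g x + g x * 'D_v f x).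
    by apply: elementary_add; exact: elementary_mul.
  by apply/funext => x; rewrite deriveM//; apply: diff_derivable; exact: D.
- move=> f ef e'f.
  rewrite (_ : 'D_v _ = fun x => expR (f x) * 'D_v f x).
    by apply: elementary_mul => //; exact: elementary_exp.
  by apply/funext => x; have [] := derive_comp1 _ _ x v _ (D _ ef x) (is_derive_expR (f x)).
- move=> n f ef e'f.
  rewrite (_ : 'D_v _ = fun x =>
      (flat n.+2 (f x) + (- n%:R) * flat n.+1 (f x)) * 'D_v f x).
    apply: elementary_mul => //; apply: elementary_add; first exact: elementary_flat.
    by apply: elementary_mul; [exact: elementary_cst|exact: elementary_flat].
  apply/funext => x; have [_ ->] := derive_comp1 _ _ x v _ (D _ ef x) (is_derive_flat n (f x)).
  by rewrite mulNr.
Qed.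

Lemma elementary_smooth {R : realType} {V : normedModType R} (f : V -> R) :
  elementary f -> smooth f.
Proof.
move=> ef k; elim: k f ef => [|k IH] f ef.
  by move=> x; apply: differentiable_continuous; exact: elementary_differentiable.
move=> v; split; last exact/IH/elementary_derive.
by move=> x; apply: diff_derivable; exact: elementary_differentiable.
Qed.

(** Since [flat 0] vanishes on the negative axis and is at least [expR (-1)] beyond
    1, composing it with itself produces a plateau without any quotient of
    functions. *)
Definition plateau {R : realType} (x : R) : R :=
  flat 0 (expR (-1) - flat 0 x) / flat 0 (expR (-1) : R).

Lemma flat0_expN1_gt0 {R : realType} : 0 < flat 0 (expR (-1) : R).
Proof. by rewrite /flat expR_gt0 expr0 invr1 mul1r expR_gt0. Qed.

Lemma plateau_ge0 {R : realType} (x : R) : 0 <= plateau x.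
Proof. by rewrite divr_ge0 ?flat_ge0. Qed.

Lemma plateau1 {R : realType} (x : R) : x <= 0 -> plateau x = 1.
Proof.
move=> x0; rewrite /plateau {2}/flat ltNge x0/= subr0 divff//.
by rewrite gt_eqF// flat0_expN1_gt0.
Qed.

Lemma plateau0 {R : realType} (x : R) : 1 <= x -> plateau x = 0.
Proof.
move=> x1; rewrite /plateau {1}/flat ifF ?mul0r//.
apply/negbTE; rewrite -leNgt subr_le0 /flat (lt_le_trans ltr01 x1).
rewrite expr0 invr1 mul1r ler_expR lerN2.
by rewrite invf_le1// (lt_le_trans ltr01 x1).
Qed.

Lemma elementary_plateau {R : realType} {V : normedModType R} (f : V -> R) :
  elementary f -> elementary (fun x => plateau (f x)).
Proof.
move=> ef; apply: elementary_mul; last exact: elementary_cst.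
apply: elementary_flat; apply: elementary_add; first exact: elementary_cst.
rewrite (_ : (fun x => _) = fun x => (-1) * flat 0 (f x)); last first.
  by apply/funext => x; rewrite mulN1r.
by apply: elementary_mul; [exact: elementary_cst|exact: elementary_flat].
Qed.

(** * Integrals of possibly nonmeasurable functions *)

(** Integrals of nonnegative functions are suprema over simple functions, so
    monotonicity needs no measurability. It is applied to functions of time such as
    the integral of [|v s x| ^ p] over a ball that moves with [s], whose measurability
    would take a separate argument. *)
Lemma ge0_le_lower_integral {d} {T : measurableType d} {R : realType}
    (mu : {measure set T -> \bar R}) (D : set T) (f g : T -> \bar R) :
  (forall x, D x -> (0 <= f x)%E) -> (forall x, D x -> (f x <= g x)%E) ->
  (\int[mu]_(x in D) f x <= \int[mu]_(x in D) g x)%E.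
Proof.
move=> f0 fg; rewrite (integral_mkcond _ f) (integral_mkcond _ g).
have g0 x : D x -> (0 <= g x)%E by move=> Dx; exact: le_trans (f0 _ Dx) (fg _ Dx).
rewrite !ge0_integralTE; [|exact: erestrict_ge0..].
apply: ereal_sup_le => _ [h /= hf <-]; exists h => // x.
apply: le_trans (hf x) _; rewrite /patch; case: ifPn => // /set_mem; exact: fg.
Qed.

(** A function that vanishes off a null set [N] lies below [+oo] on [N], and
    monotonicity concludes. *)
Lemma ae0_lower_integral {d} {T : measurableType d} {R : realType}
    (mu : {measure set T -> \bar R}) (f : T -> \bar R) :
  {ae mu, forall x, f x = 0%E} -> (\int[mu]_x f x = 0)%E.
Proof.
move=> [N [mN N0 fN]].
suff H g : (forall x, 0 <= g x)%E -> (forall x, ~ N x -> g x = 0%E) ->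
    (\int[mu]_x g x = 0)%E.
  have fN' x : ~ N x -> f x = 0%E by move=> nNx; apply: contrapT => /fN.
  rewrite integralE !H ?sube0// => x; rewrite ?funepos_ge0 ?funeneg_ge0//.
    by move=> /fN' fx; rewrite funenegE fx oppe0 maxxx.
  by move=> /fN' fx; rewrite funeposE fx maxxx.
move=> g0 gN; apply/eqP; rewrite eq_le integral_ge0// andbT.
rewrite (@le_trans _ _ (\int[mu]_(x in N) +oo)%E)//.
  rewrite [leRHS]integral_mkcond; apply: ge0_le_lower_integral => // x _.
  rewrite /patch; case: ifPn; first by rewrite leey.
  by move=> /negP xN; rewrite gN// => Nx; apply: xN; rewrite inE.
by rewrite integral_cst// N0 mule0.
Qed.

(** * Lebesgue measure on row vectors *)

(** The boxes with rational centre and radius form a countable basis, so the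
    complement of the essential support is a countable union of boxes on which
    the function vanishes almost everywhere. *)
Lemma ae0_outside_ess_supp {R : realType} n (f : 'rV[R]_n -> R) :
  {ae @lebesgue_rV R n, forall x, ~ ess_supp f x -> f x = 0}.
Proof.
pose B (j : 'rV[rat]_n * nat) : set 'rV[R]_n :=
  [set y | forall i, `|ratr (j.1 ord0 i) - y ord0 i| < j.2.+1%:R^-1].
pose null j := {ae @lebesgue_rV R n, forall y, B j y -> f y = 0}.
pose F m := if unpickle m is Some j then
  (if `[< null j >] then ~` [set y | B j y -> f y = 0] else set0) else set0.
have Fnull m : (@lebesgue_rV R n).-negligible (F m).
  rewrite /F; case: (unpickle m) => [j|]; last exact: negligible_set0.
  by case: ifPn => [/asboolP//|_]; exact: negligible_set0.
apply: negligibleS (negligible_bigcup Fnull) => x /= /not_implyP[+ fx].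
move=> /existsNP[U] /not_implyP[xU] /contrapT Unull.
have /nbhs_ballP[e /= e0 eU] := xU.
(* A box of radius less than [e / 2] around a point near [x] stays in the
   [e]-ball of [x]. *)
pose k := Num.truncn (2 / e).
have ke : k.+1%:R^-1 < e / 2.
  rewrite -[ltRHS]invf_div ltf_pV2 ?posrE ?divr_gt0//.
  by rewrite truncnS_gt// num_real.
have q_ i : {q : rat | `|ratr q - x ord0 i| < k.+1%:R^-1}.
  apply: cid.
  have := @rat_in_itvoo R (x ord0 i - k.+1%:R^-1) (x ord0 i + k.+1%:R^-1).
  case.
    by rewrite ltrD2l -subr_gt0 opprK addr_gt0// invr_gt0.
  move=> q; rewrite in_itv/= => /andP[q1 q2]; exists q.
  by rewrite ltr_distl q1 q2.
pose j := (\row_i sval (q_ i), k).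
have Bx : B j x by move=> i; rewrite /= mxE; exact: svalP (q_ i).
have BU : B j `<=` U.
  move=> y By; apply: eU; split=> // a i; rewrite /ball /= (ord1 a).
  rewrite -(subrKA (ratr (j.1 ord0 i))) (le_lt_trans (ler_normD _ _))//.
  rewrite [e]splitr ltrD//; apply: lt_trans ke; last exact: By.
  by rewrite distrC; exact: Bx.
have jnull : null j by apply: filterS Unull => y + /BU.
exists (pickle j) => //; rewrite /F pickleK ifT; last exact/asboolP.
by move=> /(_ Bx).
Qed.

Definition sqnorm {R : realType} {n} (x : 'rV[R]_n) : R := \sum_i x ord0 i ^+ 2.

Lemma sqnorm_ge0 {R : realType} n (x : 'rV[R]_n) : 0 <= sqnorm x.
Proof. by apply: sumr_ge0 => i _; exact: sqr_ge0. Qed.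

Lemma sqnorm_coord {R : realType} n (x : 'rV[R]_n) i :
  x ord0 i ^+ 2 <= sqnorm x.
Proof.
by rewrite /sqnorm (bigD1 i)//= lerDl sumr_ge0// => j _; exact: sqr_ge0.
Qed.

Lemma eball_sqnorm {R : realType} n (r : R) (x : 'rV[R]_n) : 0 <= r ->
  eball r x <-> sqnorm x <= r ^+ 2.
Proof.
move=> r0; rewrite /eball/= /enorm -/(sqnorm x).
by rewrite -[in X in _ <-> X](sqr_sqrtr (sqnorm_ge0 _ x)) ler_sqr ?nnegrE ?sqrtr_ge0.
Qed.

Lemma measurable_sqnorm {R : realType} n :
  measurable_fun setT (@sqnorm R n).
Proof.
apply: measurable_sum => i; apply: measurable_funX; exact: measurable_coord_rV.
Qed.

Lemma measurable_eball {R : realType} n (r : R) : 0 <= r ->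
  measurable (@eball R n r).
Proof.
move=> r0; rewrite (_ : eball r = @sqnorm R n @^-1` `]-oo, r ^+ 2]).
  by rewrite -[X in measurable X]setTI; exact: measurable_sqnorm.
by apply/seteqP; split => x; rewrite /= in_itv/=; apply eball_sqnorm.
Qed.

Definition cube {R : realType} n (r : R) : set 'rV[R]_n :=
  [set x | forall i, x ord0 i \in `[- r, r]%R].

Lemma eball_cube {R : realType} n (r : R) : 0 <= r -> @eball R n r `<=` cube n r.
Proof.
move=> r0 x /(eball_sqnorm _ _ _ r0) xr i; rewrite in_itv/= -ler_norml.
rewrite -[leRHS]ger0_norm// -[leRHS]sqrtr_sqr -sqrtr_sqr ler_sqrt ?sqr_ge0//.
exact: le_trans (sqnorm_coord _ _ _) xr.
Qed.

Lemma compact_cube {R : realType} n (r : R) : compact (cube n r).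
Proof.
apply: (@rV_compact R n (fun=> [set` `[- r, r]%R])) => i; exact: segment_compact.
Qed.

Lemma measurable_cube {R : realType} n (r : R) : measurable (cube n r).
Proof.
rewrite (_ : cube n r = \bigcap_(i in [set: 'I_n])
    ((fun x : 'rV[R]_n => x ord0 i) @^-1` `[- r, r])); last first.
  by apply/seteqP; split => x /= h i; [move=> _; exact: h|exact: h].
apply: fin_bigcap_measurable; first exact: finite_finset.
move=> i _; rewrite -[X in measurable X]setTI; exact: measurable_coord_rV.
Qed.

Lemma lebesgue_rV_cube {R : realType} n (r : R) : 0 <= r ->
  @lebesgue_rV R n (cube n r) = ((2 * r) ^+ n)%:E.
Proof.
move=> r0; elim: n => [|n IH].
  rewrite /= diracE mem_set//; by case.
rewrite /= /pushforward.
rewrite (_ : _ @^-1` _ = `[- r, r] `*` cube n r); last first.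
  apply/seteqP; split=> -[a y] /=.
    move=> h; split => [|i].
      have := h (@lshift 1 n ord0).
      by rewrite [X in X \in _]row_mxEl mxE eqxx.
    by have := h (@rshift 1 n i); rewrite [X in X \in _]row_mxEr.
  move=> [ha hy] i; case: (@split_ordP 1 n i) => j ->.
    by rewrite [X in X \in _]row_mxEl (ord1 j) mxE eqxx.
  by rewrite [X in X \in _]row_mxEr.
rewrite product_measure1E//; last exact: measurable_cube.
rewrite exprS EFinM; congr (_ * _)%E; last exact: IH.
rewrite [LHS](@lebesgue_measure_itv R `[- r, r])/=.
rewrite lte_fin; case: ltP => h; first by rewrite -EFinD; congr (_%:E); ring.
have -> : r = 0 by apply/eqP; rewrite eq_le r0 andbT; lra.
by rewrite mulr0.
Qed.

Lemma lebesgue_rV_eball {R : realType} n (r : R) : 0 <= r ->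
  (@lebesgue_rV R n (eball r) <= ((2 * r) ^+ n)%:E)%E.
Proof.
move=> r0; rewrite -lebesgue_rV_cube// le_measure ?inE//.
- exact: measurable_eball.
- exact: measurable_cube.
- exact: eball_cube.
Qed.

(** * Spatial integrals of a slice of the solution *)

Lemma continuous_flat {R : realType} n : continuous (flat n : R -> R).
Proof.
move=> x; apply: differentiable_continuous; apply/derivable1_diffP.
exact: (@ex_derive _ _ _ _ _ _ _ (is_derive_flat n x)).
Qed.

Definition cutoff {R : realType} {n} (rho : R) (x : 'rV[R]_n) : R :=
  plateau (sqnorm x - rho ^+ 2).

Lemma cutoff_ge0 {R : realType} n rho (x : 'rV[R]_n) : 0 <= cutoff rho x.
Proof. exact: plateau_ge0. Qed.

Lemma cutoff1 {R : realType} n (r rho : R) (x : 'rV[R]_n) : 0 <= r -> r <= rho ->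
  eball r x -> cutoff rho x = 1.
Proof.
move=> r0 rrho /(eball_sqnorm _ _ _ r0) xr; apply: plateau1.
by rewrite subr_le0 (le_trans xr)// lerXn2r ?nnegrE ?(le_trans r0).
Qed.

Lemma measurable_cutoff {R : realType} n rho :
  measurable_fun setT (@cutoff R n rho).
Proof.
have mf : measurable_fun setT (flat 0 : R -> R).
  exact: continuous_measurable_fun (continuous_flat 0).
apply: measurable_funM; last exact: measurable_cst.
apply: (measurableT_comp mf); apply: measurable_funB; first exact: measurable_cst.
apply: (measurableT_comp mf); apply: measurable_funB; last exact: measurable_cst.
exact: measurable_sqnorm.
Qed.

Definition mass {R : realType} {n} (u : 'rV[R]_n -> R) : R :=
  fine (\int[@lebesgue_rV R n]_x (u x)%:E).

Section slice.
Context {R : realType} {n : nat}.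
Variables (u : 'rV[R]_n -> R) (r : R).
Hypotheses (uL1 : L1loc u) (r0 : 0 <= r) (ur : ess_supp u `<=` eball r).
Local Notation mu := (@lebesgue_rV R n).

Lemma ae0_outside_eball : {ae mu, forall x, ~ eball r x -> u x = 0}.
Proof. by apply: filterS (ae0_outside_ess_supp _ u) => x + /(contra_not (@ur x)). Qed.

(** Stated for composites [f \o u] in order to serve both [u] and its absolute
    value. *)
Lemma integral_eball (f : R -> R) : f 0 = 0 -> measurable_fun setT (f \o u) ->
  (\int[mu]_x (f (u x))%:E = \int[mu]_(x in eball r) (f (u x))%:E)%E.
Proof.
move=> f0 mf; rewrite [RHS]integral_mkcond; apply: ae_eq_integral => //.
- exact/measurable_EFinP.
- apply/(measurable_restrictT _ (measurable_eball _ r r0)).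
  by apply/measurable_EFinP; exact: measurable_funTS.
- apply: filterS ae0_outside_eball => x ux _; rewrite /patch.
  by case: ifPn => // /negP xr; rewrite ux ?f0// => /mem_set.
Qed.

Lemma integrable_slice : mu.-integrable setT (EFin \o u).
Proof.
have [mu_ uK] := uL1.
apply/integrableP; split; first exact/measurable_EFinP.
apply: le_lt_trans (uK _ (compact_cube n r)).
rewrite [leLHS](integral_eball (fun a => `|a|)) ?normr0//; last exact: measurableT_comp.
apply: ge0_subset_integral => //.
- exact: measurable_eball.
- exact: measurable_cube.
- by apply: measurable_funTS; apply/measurable_EFinP; exact: measurableT_comp.
- exact: eball_cube.
Qed.

Lemma massE : (\int[mu]_x (u x)%:E = (mass u)%:E)%E.
Proof. by rewrite fineK// integrable_fin_num// integrable_slice. Qed.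

Lemma integral_cutoff a rho : r <= rho ->
  (\int[mu]_x (u x * (a * cutoff rho x))%:E = (a * mass u)%:E)%E.
Proof.
have [mu_ _] := uL1; move=> rrho.
rewrite EFinM -massE -integralZl//; last exact: integrable_slice.
apply: ae_eq_integral => //.
- apply/measurable_EFinP; apply: measurable_funM => //.
  by apply: measurable_funM; [exact: measurable_cst|exact: measurable_cutoff].
- by apply: measurable_funeM; exact/measurable_EFinP.
- apply: filterS ae0_outside_eball => x ux _; rewrite -EFinM.
  have [/(cutoff1 _ _ _ _ r0 rrho) ->|/ux ->] := pselect (eball r x).
    by rewrite mulr1 mulrC.
  by rewrite mul0r mulr0.
Qed.

(** Instead of Hoelder's inequality, the pointwise bound
    [|a| <= M + M ^ (1 - p) |a| ^ p] is integrated over the ball. With [M] half of the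
    mean value, the constant term absorbs half of the mass. *)
Lemma power_integral_lower_bound (p V : R) : 1 < p -> 0 < mass u -> 0 < V ->
  (mu (eball r) <= V%:E)%E ->
  ((mass u / 2 * (mass u / (2 * V)) `^ (p - 1))%:E <=
    \int[mu]_(x in eball r) (`|u x| `^ p)%:E)%E.
Proof.
move=> p1 m0 V0 BV; have [mu_ _] := uL1.
set m := mass u in m0 *; pose M := m / (2 * V).
have M0 : 0 < M by rewrite divr_gt0// mulr_gt0.
set D := eball r; set Q := (\int[mu]_(x in D) _)%E.
have mD : measurable D by exact: measurable_eball.
have Q0 : (0 <= Q)%E by apply: integral_ge0 => x _; rewrite lee_fin powR_ge0.
have mup : measurable_fun D (fun x => (`|u x| `^ p)%:E).
  apply/measurable_EFinP; apply: measurable_funTS.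
  by apply: (measurableT_comp (measurable_powR p)); exact: measurableT_comp.
have pw (a : R) : `|a| <= M + M `^ (1 - p) * `|a| `^ p.
  have [aM|Ma] := leP `|a| M.
    by rewrite (le_trans aM)// lerDl mulr_ge0 ?powR_ge0.
  have a0 : 0 < `|a| by exact: lt_trans Ma.
  rewrite ler_wpDl ?(ltW M0)// -(mulr_powRB1 (ltW a0)) ?(lt_trans ltr01)//.
  rewrite mulrCA ler_peMr ?(ltW a0)//.
  have -> : 1 - p = - (p - 1) by rewrite opprB.
  rewrite powRN mulrC ler_pdivlMr ?powR_gt0// mul1r.
  by rewrite ge0_ler_powR ?nnegrE ?subr_ge0 ?(ltW p1) ?(ltW M0) ?(ltW a0) ?(ltW Ma).
have : (m%:E <= (m / 2)%:E + (M `^ (1 - p))%:E * Q)%E.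
  have -> : m%:E = (\int[mu]_(x in D) (u x)%:E)%E by rewrite -massE (integral_eball id).
  apply: (@le_trans _ _ (\int[mu]_(x in D) `|(u x)%:E|)%E).
    apply: le_trans (le_abse_integral _ _ _) => //; first exact: lee_abs.
    by apply: measurable_funTS; exact/measurable_EFinP.
  apply: (@le_trans _ _ (\int[mu]_(x in D) (M%:E + (M `^ (1 - p))%:E * (`|u x| `^ p)%:E))%E).
    by apply: ge0_le_lower_integral => x _; rewrite ?lee_fin//= -EFinM -EFinD lee_fin.
  rewrite ge0_integralD//; [|by move=> x _; rewrite lee_fin ltW
    |by move=> x _; rewrite mule_ge0// lee_fin powR_ge0|exact: measurable_funeM].
  rewrite ge0_integralZl//; last by rewrite lee_fin powR_ge0.
  rewrite leeD2r// integral_cst// (@le_trans _ _ (M%:E * V%:E)%E)//.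
    by rewrite lee_wpmul2l// lee_fin ltW.
  by rewrite -EFinM lee_fin /M (_ : m / _ * V = m / 2)//; field; rewrite gt_eqF.
have M1 : 0 < M `^ (p - 1) by rewrite powR_gt0.
have -> : 1 - p = - (p - 1) by rewrite opprB.
rewrite powRN -/M; move: Q0; case: Q => [Q Q0|_ _|//]; last by rewrite leey.
rewrite -EFinM -EFinD !lee_fin => h.
rewrite -ler_pdivlMr//; move: h; rewrite [_^-1 * _]mulrC; lra.
Qed.

End slice.

(** * Duhamel's formula for the total mass *)

Definition time_coord {R : realType} {n} (z : R * 'rV[R]_n) : R^o := z.1.
Definition space_coord {R : realType} {n} (i : 'I_n) (z : R * 'rV[R]_n) : R^o :=
  z.2 ord0 i.

Lemma time_coord_linear {R : realType} n : linear (@time_coord R n).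
Proof. by move=> a [s x] [t y]. Qed.

Lemma space_coord_linear {R : realType} n i : linear (@space_coord R n i).
Proof. by move=> a [s x] [t y]; rewrite /space_coord /= !mxE. Qed.

Lemma elementary_time {R : realType} n :
  elementary (fun z : R * 'rV[R]_n => z.1).
Proof.
apply: (elementary_linear (@time_coord R n) (time_coord_linear n)) => z.
exact: cvg_fst.
Qed.

Lemma elementary_space {R : realType} n (i : 'I_n) :
  elementary (fun z : R * 'rV[R]_n => z.2 ord0 i).
Proof.
apply: (elementary_linear (@space_coord R n i) (space_coord_linear n i)) => z.
apply: (@continuous_comp _ _ _ snd (fun x : 'rV[R]_n => x ord0 i)).
  exact: cvg_snd.
exact: coord_continuous.
Qed.

Lemma elementary_affine {R : realType} {V : normedModType R} (f : V -> R) a c :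
  elementary f -> elementary (fun z => a * f z + c).
Proof.
move=> ef; apply: elementary_add; last exact: elementary_cst.
by apply: elementary_mul => //; exact: elementary_cst.
Qed.

Lemma elementary_sqnorm {R : realType} n :
  elementary (fun z : R * 'rV[R]_n => sqnorm z.2).
Proof.
rewrite /sqnorm; elim: (index_enum _) => [|i s IH].
  rewrite (_ : (fun z => _) = fun=> 0); first exact: elementary_cst.
  by apply/funext => z; rewrite big_nil.
rewrite (_ : (fun z => _) =
    fun z : R * 'rV[R]_n => z.2 ord0 i * z.2 ord0 i + \sum_(j <- s) z.2 ord0 j ^+ 2).
  by apply: elementary_add => //; apply: elementary_mul; exact: elementary_space.
by apply/funext => z; rewrite big_cons expr2.
Qed.

Lemma elementary_cutoff {R : realType} n rho :
  elementary (fun z : R * 'rV[R]_n => cutoff rho z.2).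
Proof.
apply: elementary_plateau; apply: elementary_add; last exact: elementary_cst.
exact: elementary_sqnorm.
Qed.

(** Along the time axis the second factor is frozen, so no regularity of [g] is
    involved. *)
Lemma dt_separated {R : realType} n (G : R -> R) (g : 'rV[R]_n -> R)
    (s : R) x dG :
  is_derive s 1 G dG -> dt (fun z : R * 'rV[R]_n => G z.1 * g z.2) (s, x) = dG * g x.
Proof.
move=> dGs; transitivity ('D_1 (fun s => G s * g x) s).
  rewrite /dt /derive; do 2 f_equal; apply/funext => h /=.
  by rewrite scaler0 add0r.
have [dg <-] := dGs; have -> : (fun s => G s * g x) = g x \*: G.
  by apply/funext => y; rewrite /GRing.scale/= mulrC.
by rewrite deriveZ// mulrC.
Qed.

Lemma dx_time {R : realType} n i (G : R -> R) (z : R * 'rV[R]_n) :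
  dx i (fun z : R * 'rV[R]_n => G z.1) z = 0.
Proof.
apply: cvg_lim => //; apply: cvg_near_cst; near=> h.
by rewrite /= scaler0 add0r subrr scaler0.
Unshelve. all: by end_near.
Qed.

Lemma near_lt {R : realType} {V : normedModType R} (f : V -> R) z c :
  elementary f -> f z < c -> \near z, f z < c.
Proof.
move=> ef fz; have cf := differentiable_continuous (elementary_differentiable f ef z).
exact: cf _ (lt_nbhsl fz).
Qed.

Lemma light_cone_lt {R : realType} (c H s t : R) : 0 < c -> 0 < H -> s < t ->
  light_cone c H s < light_cone c H t.
Proof.
move=> c0 H0 st; rewrite ltr_pM2l ?divr_gt0//.
by rewrite ltrD2r ltr_expR ltr_pM2l.
Qed.

Lemma light_cone_ge0 {R : realType} (c H s : R) : 0 < c -> 0 < H -> 0 <= s ->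
  0 <= light_cone c H s.
Proof.
move=> c0 H0 s0; rewrite mulr_ge0 ?divr_ge0 ?(ltW c0) ?(ltW H0)//.
by rewrite subr_ge0 -expR0 ler_expR mulr_ge0// ltW.
Qed.

(** A test function of the form [kappa(s) chi(x)] up to the time [t1]. The plateau
    in time falls from 1 at [t1] to 0 at [t2], which keeps the support away from
    later times. *)
Section separated_test_function.
Context {R : realType} {n : nat}.
Variables (kappa kappa1 kappa2 : R -> R) (t1 t2 rho : R).
Hypotheses (t12 : t1 < t2) (rho0 : 0 <= rho).
Hypothesis kappa_el : elementary (fun z : R * 'rV[R]_n => kappa z.1).
Hypothesis dkappa : forall s : R, is_derive s 1 kappa (kappa1 s).
Hypothesis dkappa1 : forall s : R, is_derive s 1 kappa1 (kappa2 s).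

Definition separated (z : R * 'rV[R]_n) : R :=
  kappa z.1 * plateau ((t2 - t1)^-1 * z.1 + - t1 / (t2 - t1)) * cutoff rho z.2.

Let t120 : 0 < t2 - t1. Proof. by rewrite subr_gt0. Qed.

Lemma test_function_separated (T : \bar R) : (t2%:E < T)%E ->
  test_function T separated.
Proof.
move=> t2T; split.
  apply: elementary_smooth; apply: elementary_mul; last exact: elementary_cutoff.
  apply: elementary_mul => //; apply: elementary_plateau.
  exact: elementary_affine (elementary_time n).
exists (`[0, t2] `*` cube n (rho + 1)); split.
- by apply: compact_setX; [exact: segment_compact|exact: compact_cube].
- move=> [s x] /= [+ _]; rewrite in_itv/= => /andP[s0 st2]; split => //.
  by rewrite (le_lt_trans _ t2T)// lee_fin.
move=> [s x] /= s0 sT; rewrite /separated/=.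
have [st2|t2s _] := leP s t2; last first.
  rewrite plateau0 ?mulr0 ?mul0r// mulNr [_ * s]mulrC -mulrBl.
  by rewrite ler_pdivlMr// mul1r lerB// ltW.
have [//|xcube] := pselect (cube n (rho + 1) x).
  by move=> xc [] //; rewrite /= in_itv/= s0.
move=> _; move/existsNP: xcube => [i] /negP; rewrite in_itv/= -ler_norml -ltNge => xi.
rewrite [cutoff _ _]plateau0 ?mulr0// lerBrDr.
apply: le_trans (sqnorm_coord _ x i); rewrite -[leRHS]real_normK ?num_real//.
apply: (@le_trans _ _ ((rho + 1) ^+ 2)).
  by have := rho0; rewrite sqrrD mulr1 expr1n -mulr_natl; lra.
by rewrite lerXn2r ?nnegrE// ?addr_ge0// ltW.
Qed.

Lemma separatedE s x : s <= t1 -> separated (s, x) = kappa s * cutoff rho x.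
Proof.
move=> st1; rewrite /separated /= plateau1 ?mulr1//.
by rewrite mulNr [_ * s]mulrC -mulrBl pmulr_lle0 ?invr_gt0// subr_le0.
Qed.

Lemma dt_separatedE s x : s < t1 -> dt separated (s, x) = kappa1 s * cutoff rho x.
Proof.
move=> st1; rewrite -(dt_separated _ _ (cutoff rho) _ _ _ (dkappa s)).
apply: near_eq_derive; near=> z; rewrite -separatedE -?surjective_pairing//.
apply: ltW; near: z; exact: near_lt (elementary_time n) _.
Unshelve. all: by end_near.
Qed.

Lemma dtdt_separatedE s x : s < t1 ->
  dt (dt separated) (s, x) = kappa2 s * cutoff rho x.
Proof.
move=> st1; rewrite -(dt_separated _ _ (cutoff rho) _ _ _ (dkappa1 s)).
apply: near_eq_derive; near=> z; rewrite -dt_separatedE -?surjective_pairing//.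
near: z; exact: near_lt (elementary_time n) _.
Unshelve. all: by end_near.
Qed.

Lemma laplacian_separatedE s x : s < t1 -> sqnorm x < rho ^+ 2 ->
  laplacian separated (s, x) = 0.
Proof.
move=> st1 xrho; apply: big1 => i _.
pose U (z : R * 'rV[R]_n) := z.1 < t1 /\ sqnorm z.2 < rho ^+ 2.
have nearU z : U z -> \near z, U z.
  move=> [z1 z2]; near=> y; split; near: y.
    exact: near_lt (elementary_time n) _.
  exact: near_lt (elementary_sqnorm n) _.
have dx0 z : U z -> dx i separated z = 0.
  move=> Uz; rewrite -[RHS](dx_time n i kappa z).
  apply: near_eq_derive; near=> y.
  have [y1 y2] : U y by near: y; exact: nearU.
  rewrite [in LHS](surjective_pairing y) separatedE ?ltW// /cutoff plateau1 ?mulr1//.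
  by rewrite subr_le0 ltW.
rewrite -[RHS](dx_time n i (cst 0) (s, x)).
apply: near_eq_derive; near=> y; apply: dx0; near: y.
exact: (nearU (s, x)).
Unshelve. all: by end_near.
Qed.

End separated_test_function.

Lemma lt_EFin_between {R : realType} (t : R) (T : \bar R) : (t%:E < T)%E ->
  exists2 t2, t < t2 & (t2%:E < T)%E.
Proof.
case: T => [T| |//]; last by exists (t + 1); rewrite ?ltrDl ?ltry.
by rewrite lte_fin => tT; exists ((t + T) / 2); rewrite ?midf_lt// lte_fin midf_lt.
Qed.

Definition cone_power {R : realType} {n} (c H p Rad : R) (v : R -> 'rV[R]_n -> R)
    (s : R) : \bar R :=
  (\int[@lebesgue_rV R n]_(x in eball (Rad + light_cone c H s)) (`|v s x| `^ p)%:E)%E.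

(** Testing against [k (t - s)], where [k] solves [k'' + b k' + m2 k = 0]
    with [k 0 = 0] and [k' 0 = 1], removes every linear term inside the light cone
    except the mass at time [t]: the variation of constants formula. Only one
    inequality is stated, as both powers of the nonlinearity are bounded below by
    integrals over the light cone; time 0 is discarded because the support
    condition concerns positive times. *)
Lemma duhamel_mass {R : realType} n (c H b m2 beta p Rad eps : R) (Gamma : R -> R)
    (v0 v1 : 'rV[R]_n -> R) (T : \bar R) (v : R -> 'rV[R]_n -> R)
    (k k1 k2 : R -> R) (t : R) :
  0 < c -> 0 < H -> 0 < Rad -> 0 <= beta ->
  L1loc v0 -> L1loc v1 -> ess_supp v0 `<=` eball Rad -> ess_supp v1 `<=` eball Rad ->
  (forall s, 0 <= s -> 0 <= Gamma s) ->
  (forall s, 0 <= s -> 0 <= k s) -> k 0 = 0 -> k1 0 = 1 ->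
  (forall s : R, is_derive s 1 k (k1 s)) -> (forall s : R, is_derive s 1 k1 (k2 s)) ->
  (forall s, k2 s + b * k1 s + m2 * k s = 0) ->
  elementary (fun z : R * 'rV[R]_n => k (t - z.1)) ->
  weak_solution c H b m2 beta p Gamma eps Rad v0 v1 T v ->
  0 < t -> (t%:E < T)%E ->
  ((eps * (k t * mass v1 + (b * k t + k1 t) * mass v0))%:E +
   \int[lebesgue_measure]_(s in `[0%R, t])
     (if (0 < s)%R then (Gamma s * k (t - s))%:E * cone_power c H p Rad v s `^ beta *
        cone_power c H p Rad v s else 0)
   <= (mass (v t))%:E)%E.
Proof.
move=> c0 H0 Rad0 beta0 v0L v1L v0r v1r G0 k0 kz k1z dk dk1 ode kel.
move=> [dv [C1 _ supp id]] t0 tT.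
have [t2 tt2 t2T] := lt_EFin_between _ _ tT.
(* The cut-off in time acts on [t1, t2], strictly beyond [t], so that even the
   derivatives of the test function are unaffected up to [t]. *)
pose t1 := (t + t2) / 2.
have [tt1 t12] : t < t1 /\ t1 < t2 by rewrite !midf_lt.
pose rad s := Rad + light_cone c H s; pose rho := rad t1.
have rad_ge0 s : 0 <= s -> 0 <= rad s by move=> s0; rewrite addr_ge0 ?(ltW Rad0)// light_cone_ge0.
have rad_lt s : s < t1 -> rad s < rho.
  by move=> st; rewrite ltrD2l light_cone_lt.
have rho0 : 0 <= rho by rewrite rad_ge0// ltW// (lt_trans t0).
have Radrho : Rad <= rho by rewrite lerDl light_cone_ge0// ltW// (lt_trans t0).
have dsub (s : R) : is_derive s 1 (fun s => t - s) (-1 : R).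
  by have /is_derive_eq := is_deriveB (is_derive_cst t s 1) (is_derive_id s 1);
    apply; rewrite sub0r.
have dkappa (s : R) : is_derive s 1 (fun s => k (t - s)) (- k1 (t - s)).
  have /is_derive_eq := @is_derive1_comp R k (fun s => t - s) s _ _ (dk _) (dsub s).
  by apply; rewrite mulrN1.
have dkappa1 (s : R) : is_derive s 1 (fun s => - k1 (t - s)) (k2 (t - s)).
  have := @is_derive1_comp R k1 (fun s => t - s) s _ _ (dk1 _) (dsub s).
  by move=> /is_deriveN /is_derive_eq; apply; rewrite mulrN1 opprK.
pose phi : R * 'rV[R]_n -> R := separated (fun s => k (t - s)) t1 t2 rho.
have tphi : test_function T phi by exact: test_function_separated.
have phiE s x : s <= t1 -> phi (s, x) = k (t - s) * cutoff rho x.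
  by move=> st; rewrite /phi separatedE.
have dphiE s x : s < t1 -> dt phi (s, x) = - k1 (t - s) * cutoff rho x.
  by move=> st; rewrite /phi; exact: (dt_separatedE _ (fun s => - k1 (t - s))).
have ddphiE s x : s < t1 -> dt (dt phi) (s, x) = k2 (t - s) * cutoff rho x.
  move=> st; rewrite /phi.
  exact: (dtdt_separatedE _ (fun s => - k1 (t - s)) (fun s => k2 (t - s))).
have t10 : 0 < t1 by exact: lt_trans tt1.
have vL s : 0 <= s -> (s%:E < T)%E -> L1loc (v s) by move=> s0 /(C1 _ s0)[].
have sT s : s <= t -> (s%:E < T)%E by move=> st; apply: le_lt_trans tT; rewrite lee_fin.
have := id t t0 tT phi tphi; rewrite /integral_identity.
rewrite [X in (X - _ + _ + _)%E = _](_ : _ = 0%E); last first.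
  by apply: integral0_eq => x _; rewrite phiE ?ltW// subrr kz mul0r mulr0.
rewrite [X in (_ - X + _ + _)%E = _](_ : _ = (- mass (v t))%:E); last first.
  rewrite -mulN1r -(integral_cutoff _ _ (vL _ (ltW t0) tT) (rad_ge0 _ (ltW t0))
    (supp _ t0 tT) _ rho)//;
    last exact/ltW/rad_lt.
  by apply: eq_integral => x _; rewrite dphiE// subrr k1z.
rewrite [X in (_ + _ * X + _)%E = _](_ : _ = 0%E); last first.
  by apply: integral0_eq => x _; rewrite phiE ?ltW// subrr kz mul0r mulr0.
rewrite [X in (_ + X)%E = _](_ : _ = 0%E); last first.
  rewrite integral_mkcond; apply: ae0_lower_integral.
  (* The support of [v 0] is not controlled, hence the null set of times. *)
  exists [set 0]; split; [exact: measurable_set1|exact: lebesgue_measure_set1|].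
  move=> s /=; apply: contra_notP => s_neq0; rewrite /patch; case: ifPn => //.
  rewrite inE/= in_itv/= => /andP[s0 st].
  have {s_neq0}s0' : 0 < s by rewrite lt_neqAle s0 andbT eq_sym; exact/eqP.
  have st1 : s < t1 by exact: le_lt_trans st _.
  apply: ae0_lower_integral.
  have := ae0_outside_eball (v s) (rad s) (supp s s0' (sT _ st)).
  apply: filterS => x vx; congr (_%:E).
  have [xr|/vx ->] := pselect (eball (rad s) x); last by rewrite mul0r.
  rewrite ddphiE// dphiE// phiE ?(ltW st1)//.
  rewrite laplacian_separatedE//; last first.
    apply: (le_lt_trans ((eball_sqnorm _ _ _ (rad_ge0 _ s0)).1 xr)).
    by rewrite ltrXn2r ?nnegrE ?rad_ge0// rad_lt.
  rewrite (cutoff1 _ _ _ _ (rad_ge0 _ s0) (ltW (rad_lt _ st1)) xr).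
  by have := ode (t - s); rewrite !mulr1 mulr0 subr0 mulrN opprK => ->; rewrite mulr0.
rewrite [X in _ = (_ * X + _ + _)%E](_ : _ = (k t * mass v1)%:E); last first.
  rewrite -(integral_cutoff _ _ v1L (ltW Rad0) v1r _ rho)//.
  by apply: eq_integral => x _; rewrite phiE ?(ltW t10)// subr0.
rewrite [X in _ = (_ + _ * X + _)%E](_ : _ = ((b * k t + k1 t) * mass v0)%:E); last first.
  rewrite -(integral_cutoff _ _ v0L (ltW Rad0) v0r _ rho)//.
  apply: eq_integral => x _; rewrite phiE ?(ltW t10)// dphiE// subr0.
  by congr ((_ * _)%:E); ring.
rewrite mule0 !adde0 add0e -EFinN opprK -!EFinM -EFinD -mulrDr => ->.
rewrite leeD2l//; apply: ge0_le_lower_integral => s /=; rewrite in_itv/= => /andP[s0 st].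
  case: ifPn => // _; rewrite !mule_ge0 ?poweR_ge0 ?lee_fin ?mulr_ge0 ?G0 ?k0 ?subr_ge0//.
  by apply: integral_ge0 => x _; rewrite lee_fin powR_ge0.
have st1 : s < t1 by exact: le_lt_trans st _.
have P0 : (0 <= \int[@lebesgue_rV R n]_y (`|v s y| `^ p)%:E)%E.
  by apply: integral_ge0 => x _; rewrite lee_fin powR_ge0.
have phi0 x : 0 <= phi (s, x).
  by rewrite phiE ?(ltW st1)// mulr_ge0 ?cutoff_ge0 ?k0 ?subr_ge0.
have I0 : (0 <= \int[@lebesgue_rV R n]_x (`|v s x| `^ p * phi (s, x))%:E)%E.
  by apply: integral_ge0 => x _; rewrite lee_fin mulr_ge0 ?powR_ge0.
case: ifPn => s0'; last by rewrite !mule_ge0 ?poweR_ge0 ?lee_fin ?G0.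
have Q0 : (0 <= cone_power c H p Rad v s)%E.
  by apply: integral_ge0 => x _; rewrite lee_fin powR_ge0.
have QP : (cone_power c H p Rad v s <= \int[@lebesgue_rV R n]_y (`|v s y| `^ p)%:E)%E.
  rewrite /cone_power integral_mkcond; apply: ge0_le_lower_integral => x _.
    by apply: erestrict_ge0 => y _; rewrite lee_fin powR_ge0.
  by rewrite /patch; case: ifPn => // _; rewrite lee_fin powR_ge0.
rewrite EFinM -!muleA lee_wpmul2l ?lee_fin ?G0//.
rewrite muleCA lee_pmul//.
- exact: poweR_ge0.
- by rewrite mule_ge0// lee_fin k0// subr_ge0.
- by apply: gt0_ler_poweR => //; rewrite in_itv/= leey andbT.
have [mvs _] := vL s s0 (sT _ st).
rewrite -ge0_integralZl//; last 3 first.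
- exact: measurable_eball (rad_ge0 _ s0).
- apply/measurable_EFinP; apply: measurable_funTS.
  by apply: (measurableT_comp (measurable_powR p)); exact: measurableT_comp.
- by rewrite lee_fin k0// subr_ge0.
rewrite integral_mkcond; apply: ge0_le_lower_integral => x _.
  apply: erestrict_ge0 => y _.
  by rewrite -EFinM lee_fin mulr_ge0 ?powR_ge0// k0// subr_ge0.
rewrite /patch; case: ifPn => [/set_mem xr|_]; last first.
  by rewrite lee_fin mulr_ge0 ?powR_ge0.
rewrite -EFinM lee_fin phiE ?(ltW st1)//.
by rewrite (cutoff1 _ _ _ _ (rad_ge0 _ s0) (ltW (rad_lt _ st1)) xr) mulr1 mulrC.
Qed.

(** * The iteration *)

(** A self-improving lower bound on the logarithmic time scale forces a finite
    horizon. Level [M] holding from log-time [x] on yields level [B * M] from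
    log-time [x + 2 ^- j + L * 2 ^- j] on: the factor [B ^ (q - 1) >= 4] pays for
    both the shrinking margin [delta = 2 ^- j] and the shrinking waiting time, so
    that infinitely many gains are collected before log-time [2 * (1 + L)]. *)
Lemma log_time_bound {R : realType} (q c0 M0 : R) (I : R -> Prop) (Y : R -> R) :
  1 < q -> 0 < c0 -> 0 < M0 ->
  (forall t, I t -> M0 <= Y t) ->
  (forall x delta M t, 0 <= x -> 0 < delta -> delta <= 1 -> 0 < M ->
     (forall s, I s -> x <= ln (1 + s) -> M <= Y s) ->
     I t -> x + delta <= ln (1 + t) ->
     c0 * delta * M `^ q * (ln (1 + t) - delta - x) <= Y t) ->
  forall t, I t ->
  ln (1 + t) <= 2 * (1 + (2 + 4 `^ (q - 1)^-1) / c0 * M0 `^ (1 - q)).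
Proof.
move=> q1 c0_gt0 M0_gt0 Y0 step.
set B := 2 + _; set L := _ * M0 `^ _.
have q10 : 0 < q - 1 by rewrite subr_gt0.
have B2 : 2 <= B by rewrite lerDl powR_ge0.
have B0 : 0 < B by rewrite (lt_le_trans _ B2).
have L0 : 0 < L by rewrite mulr_gt0 ?divr_gt0 ?powR_gt0.
have Bq : 4 <= B `^ (q - 1).
  have {1}-> : 4 = (4 `^ (q - 1)^-1) `^ (q - 1) :> R.
    by rewrite -powRrM mulVf ?powRr1// gt_eqF.
  rewrite ge0_ler_powR ?nnegrE ?powR_ge0 ?(ltW q10) ?(ltW B0)//.
  by rewrite lerDr.
pose x j : R := (1 + L) * 2 * (1 - 2 ^- j).
pose M j : R := M0 * B ^+ j.
have M_gt0 j : 0 < M j by rewrite mulr_gt0// exprn_gt0.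
have claim j : forall s, I s -> x j <= ln (1 + s) -> M j <= Y s.
  elim: j => [|j IH] s Is xs; first by rewrite /M expr0 mulr1 Y0.
  have d0 : 0 < 2 ^- j :> R by rewrite invr_gt0 exprn_gt0.
  have d1 : 2 ^- j <= 1 :> R by rewrite invf_le1 ?exprn_gt0// exprn_ege1// ler1n.
  have xS : x j.+1 = x j + 2 ^- j + L * 2 ^- j.
    by rewrite /x exprS invfM; field; rewrite expf_neq0.
  have x0 : 0 <= x j by rewrite !mulr_ge0// ?subr_ge0// addr_ge0 ?ltW.
  have Ld : 0 < L * 2 ^- j by rewrite mulr_gt0.
  have := step _ _ _ _ x0 d0 d1 (M_gt0 j) IH Is.
  have xd : x j + 2 ^- j <= ln (1 + s) by move: xs; rewrite xS; lra.
  move/(_ xd); apply: le_trans.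
  have Ls : L * 2 ^- j <= ln (1 + s) - 2 ^- j - x j by move: xs; rewrite xS; lra.
  apply: (@le_trans _ _ (c0 * 2 ^- j * M j `^ q * (L * 2 ^- j))); last first.
    by rewrite ler_wpM2l// !mulr_ge0 ?powR_ge0 ?ltW.
  have -> : M j `^ q = M j * M j `^ (q - 1).
    by rewrite mulr_powRB1 ?(ltW (M_gt0 j))// (lt_trans ltr01).
  have Mq : M0 `^ (q - 1) * 4 ^+ j <= M j `^ (q - 1).
    rewrite /M powRM ?(ltW M0_gt0) ?exprn_ge0 ?(ltW B0)//.
    rewrite ler_wpM2l ?powR_ge0// -[B ^+ j]powR_mulrn ?(ltW B0)// powRAC.
    by rewrite powR_mulrn ?powR_ge0// lerXn2r ?nnegrE ?powR_ge0.
  rewrite /M exprSr mulrA -/(M j).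
  have M1 : M0 `^ (1 - q) * M0 `^ (q - 1) = 1.
    rewrite -powRD; last by rewrite (gt_eqF M0_gt0) implybT.
    by rewrite (_ : 1 - q + (q - 1) = 0) ?powRr0//; ring.
  have -> : M j * B = c0 * 2 ^- j * (M j * (M0 `^ (q - 1) * 4 ^+ j)) * (L * 2 ^- j).
    have -> : 4 ^+ j = 2 ^+ j * 2 ^+ j :> R.
      by rewrite -exprMn; congr (_ ^+ _); rewrite -natrM.
    rewrite /L; set P := M0 `^ (q - 1) in M1 *; set N := M0 `^ (1 - q) in M1 *.
    transitivity (M j * B * (N * P)); first by rewrite M1 mulr1.
    by field; rewrite ?(gt_eqF c0_gt0) ?expf_neq0 ?pnatr_eq0.
  rewrite ler_wpM2r ?(ltW Ld)// ler_wpM2l ?mulr_ge0 ?(ltW c0_gt0) ?(ltW d0)//.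
  by rewrite ler_wpM2l// ltW.
move=> t It; rewrite leNgt; apply/negP => h.
pose j := (Num.truncn (Y t / M0)).+1.
have : M j <= Y t.
  apply: claim => //; apply: le_trans (ltW h).
  rewrite /x [leRHS]mulrC ler_piMr ?mulr_ge0 ?addr_ge0 ?(ltW L0)//.
apply/negP; rewrite -ltNge /M mulrC -ltr_pdivrMr//.
apply: (@lt_trans _ _ j%:R); first by rewrite truncnS_gt// num_real.
apply: (@lt_le_trans _ _ (2 ^+ j)); first by rewrite -natrX ltr_nat ltn_expl.
by rewrite lerXn2r ?nnegrE ?(ltW B0).
Qed.

(** * The borderline weight *)

Lemma mass_gt0 {R : realType} n (u : 'rV[R]_n -> R) (r : R) :
  L1loc u -> 0 <= r -> ess_supp u `<=` eball r ->
  {ae @lebesgue_rV R n, forall x, 0 <= u x} ->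
  ~ {ae @lebesgue_rV R n, forall x, u x = 0} -> 0 < mass u.
Proof.
move=> uL r0 ur u0 un0; have [mu_ _] := uL.
have E : (\int[@lebesgue_rV R n]_x `|(u x)%:E| = (mass u)%:E)%E.
  rewrite -(massE u r)//; apply: ae_eq_integral => //.
  - by apply: measurableT_comp => //; exact/measurable_EFinP.
  - exact/measurable_EFinP.
  - by apply: filterS u0 => x ux _; rewrite gee0_abs.
have m0 : 0 <= mass u by rewrite -lee_fin -E; exact: integral_ge0.
rewrite lt_neqAle m0 andbT; apply/eqP => /esym m_eq0; apply: un0.
have mf : measurable_fun setT (EFin \o u) by exact/measurable_EFinP.
have /(ae_eq_integral_abs _ measurableT mf) :
    (\int[@lebesgue_rV R n]_(x in setT) `|(u x)%:E| = 0)%E by rewrite E m_eq0.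
by apply: filterS => x /(_ I) [].
Qed.

Lemma continuous_inv1D {R : realType} (A B : R) : 0 <= A ->
  {within `[A, B], continuous (fun s : R => (1 + s)^-1)}.
Proof.
move=> A0; apply: continuous_in_subspaceT => s; rewrite inE/= in_itv/= => /andP[As _].
have s1 : 1 + s != 0 by rewrite gt_eqF// ltr_pwDl// (le_trans A0).
by apply: cvgV => //; apply: cvgD; [exact: cvg_cst|exact: cvg_id].
Qed.

Lemma integral_inv1D {R : realType} (A B C : R) : 0 <= A -> A < B -> 0 <= C ->
  (\int[lebesgue_measure]_(s in `]A, B]) (C * (1 + s)^-1)%:E =
   (C * (ln (1 + B) - ln (1 + A)))%:E)%E.
Proof.
move=> A0 AB C0.
have dln (s : R) : 0 <= s -> is_derive s 1 (fun s => ln (1 + s)) (1 + s)^-1.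
  move=> s0; have s1 : 0 < 1 + s by rewrite ltr_pwDl.
  have d1 : is_derive s 1 (fun s : R => 1 + s) 1.
    have /is_derive_eq := is_deriveD (is_derive_cst (1:R) s 1) (is_derive_id s 1).
    by apply; rewrite add0r.
  have /is_derive_eq := @is_derive1_comp R (@ln R) (fun s => 1 + s) s _ _ (is_derive1_ln s1) d1.
  by apply; rewrite mulr1.
have cln (s : R) : 0 <= s -> {for s, continuous (fun s : R => ln (1 + s))}.
  move=> s0; apply: differentiable_continuous; apply/derivable1_diffP.
  exact: (@ex_derive _ _ _ _ _ _ _ (dln s s0)).
have cinv := continuous_inv1D A B A0.
have minv : measurable_fun `[A, B] (fun s : R => (1 + s)^-1).
  by apply: subspace_continuous_measurable_fun => //; exact: measurable_itv.
rewrite integral_itv_obnd_cbnd; last first.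
  apply/measurable_EFinP; apply: measurable_funM; first exact: measurable_cst.
  by apply: measurable_funS minv; [exact: measurable_itv|exact: subset_itv_oc_cc].
rewrite (_ : \int[_]_(s in _) _ =
    \int[lebesgue_measure]_(s in `[A, B]) (C%:E * ((1 + s)^-1)%:E))%E; last first.
  by apply: eq_integral => s _; rewrite EFinM.
rewrite ge0_integralZl//; last 2 first.
- exact/measurable_EFinP.
- move=> s; rewrite /= in_itv/= => /andP[As _].
  by rewrite lee_fin invr_ge0 addr_ge0// (le_trans A0).
rewrite (@continuous_FTC2 _ _ (fun s => ln (1 + s)) _ _ AB cinv) -?EFinB -?EFinM//.
- split.
  + move=> s; rewrite in_itv/= => /andP[As _].
    exact: (@ex_derive _ _ _ _ _ _ _ (dln s (ltW (le_lt_trans A0 As)))).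
  + by apply: cvg_at_right_filter; exact: cln.
  + by apply: cvg_at_left_filter; apply: cln; rewrite ltW// (le_lt_trans A0).
- move=> s; rewrite in_itv/= => /andP[As _]; rewrite derive1E.
  by have [_ ->] := dln s (ltW (le_lt_trans A0 As)).
Qed.

Lemma ler_powR_profile {R : realType} (p V X m : R) : 1 < p -> 0 < V -> 0 < X ->
  X <= m -> X / 2 * (X / (2 * V)) `^ (p - 1) <= m / 2 * (m / (2 * V)) `^ (p - 1).
Proof.
move=> p1 V0 X0 Xm; have V20 : 0 < 2 * V by rewrite mulr_gt0.
apply: ler_pM; rewrite ?powR_ge0 ?divr_ge0 ?(ltW X0)//.
  by rewrite ler_pM2r.
rewrite ge0_ler_powR ?subr_ge0 ?(ltW p1)// ?nnegrE ?ler_pM2r ?invr_gt0//.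
  by rewrite divr_ge0 ?ltW.
by rewrite divr_ge0 ?(ltW V20)// (le_trans (ltW X0)).
Qed.

Lemma lebesgue_cone {R : realType} n (c H Rad s : R) : 0 < c -> 0 < H -> 0 < Rad ->
  0 <= s ->
  (@lebesgue_rV R n (eball (Rad + light_cone c H s)) <=
    ((2 * (Rad + c / H) * expR (H * s)) ^+ n)%:E)%E.
Proof.
move=> c0 H0 Rad0 s0; have r0 := light_cone_ge0 c H s c0 H0 s0.
have rad0 : 0 <= Rad + light_cone c H s by rewrite addr_ge0// ltW.
apply: (le_trans (lebesgue_rV_eball _ _ rad0)); rewrite lee_fin -mulrA.
have e1 : 1 <= expR (H * s) by rewrite -expR0 ler_expR mulr_ge0// ltW.
have cH : 0 < c / H by rewrite divr_gt0.
apply: lerXn2r; rewrite ?nnegrE.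
- by rewrite mulr_ge0.
- by rewrite mulr_ge0// mulr_ge0 ?expR_ge0// addr_ge0 ?ltW.
- by rewrite ler_pM2l// /light_cone; nra.
Qed.

(** The factors are the coefficient of the nonlinearity, the halving of the mass in
    [power_integral_lower_bound] and the volume of the ball in [lebesgue_cone] at
    time 0, each to the power with which it enters the source term. *)
Definition profile_constant {R : realType} (n : nat) (c H beta p mu Rad : R) : R :=
  mu * expR (- ((beta + 1) * p) * ln 2
             - (p - 1) * (beta + 1) * (n%:R * ln (2 * (Rad + c / H)))).

(** The critical exponents are exactly those for which, after the homogeneous decay
    [e ^ (- a t)] and the growth [w] have been factored out, the nonlinear source
    carries the borderline weight [(1 + s) ^ -1]. *)
Lemma critical_balance {R : realType} (n : nat) (c H b m2 beta p mu Rad s t w M k : R) :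
  let d := Num.sqrt (b ^+ 2 - 4 * m2) in
  let a := (b - d) / 2 in
  let q := (beta + 1) * p in
  let X := expR (- a * s) * w * M in
  let V := (2 * (Rad + c / H) * expR (H * s)) ^+ n in
  let Q := X / 2 * (X / (2 * V)) `^ (p - 1) in
  0 < c -> 0 < H -> 0 < Rad -> 0 <= beta -> 0 <= s -> 0 < w -> 0 < M ->
  w `^ q * (1 + s) `^ kappa_crit b m2 beta p = (1 + s)^-1 ->
  Gamma_crit n H b m2 beta p mu s * (expR (- a * (t - s)) * k) * (Q `^ beta * Q) =
  profile_constant n c H beta p mu Rad * M `^ q * expR (- a * t) * (1 + s)^-1 * k.
Proof.
move=> d a q X V Q c0 H0 Rad0 beta0 s0 w0 M0 hw.
have s1 : 0 < 1 + s by rewrite ltr_pwDl.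
have D0 : 0 < 2 * (Rad + c / H) by rewrite mulr_gt0// addr_gt0// divr_gt0.
(* All factors are positive, so the identity is linear in their logarithms. *)
have two : 2 = expR (ln 2) :> R by rewrite lnK ?posrE.
have wE : w = expR (ln w) by rewrite lnK ?posrE.
have ME : M = expR (ln M) by rewrite lnK ?posrE.
have DE : 2 * (Rad + c / H) = expR (ln (2 * (Rad + c / H))) by rewrite lnK ?posrE.
have sE : 1 + s = expR (ln (1 + s)) by rewrite lnK ?posrE.
set kap := kappa_crit _ _ _ _ in hw *.
have {}hw : q * ln w + kap * ln (1 + s) = - ln (1 + s).
  by rewrite -2!ln_powR -lnM ?posrE ?powR_gt0// hw lnV.
have XE : X = expR (- a * s + ln w + ln M) by rewrite !expRD -wE -ME.
have VE : V = expR (n%:R * (ln (2 * (Rad + c / H)) + H * s)).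
  by rewrite expRM_natl expRD -DE.
have X2E : X / 2 = expR (- a * s + ln w + ln M - ln 2).
  by rewrite expRD expRN -XE -two.
have QE : Q = expR (- a * s + ln w + ln M - ln 2 + (p - 1) *
    (- a * s + ln w + ln M - ln 2 - n%:R * (ln (2 * (Rad + c / H)) + H * s))).
  rewrite /Q invfM mulrA X2E VE -expRN -expRD -expRM -expRD.
  by congr expR; ring.
have QbE : Q `^ beta * Q = expR ((beta + 1) * (- a * s + ln w + ln M - ln 2 + (p - 1) *
    (- a * s + ln w + ln M - ln 2 - n%:R * (ln (2 * (Rad + c / H)) + H * s)))).
  by rewrite QE -expRM -expRD; congr expR; ring.
rewrite QbE /Gamma_crit -/kap /profile_constant.
rewrite [(1 + s) `^ _]/powR (gt_eqF s1) [M `^ _]/powR (gt_eqF M0).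
rewrite [(1 + s)^-1](_ : _ = expR (- ln (1 + s))); last by rewrite expRN -sE.
rewrite -{}hw.
transitivity (mu * k * expR (rho_crit n H b m2 beta p * s + kap * ln (1 + s) - a * (t - s) +
  (beta + 1) * (- a * s + ln w + ln M - ln 2 + (p - 1) *
    (- a * s + ln w + ln M - ln 2 - n%:R * (ln (2 * (Rad + c / H)) + H * s))))).
  rewrite [- a * (t - s)]mulNr !expRD; ring.
set L := ln (2 * _).
transitivity (mu * k * expR (- ((beta + 1) * p) * ln 2 - (p - 1) * (beta + 1) * (n%:R * L)
  + q * ln M - a * t + (q * ln w + kap * ln (1 + s)))).
  congr (_ * expR _); rewrite /rho_crit -/d /a /q; by field.
rewrite [- a * t]mulNr !expRD; ring.
Qed.

(** * The lifespan in the critical case *)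

Section critical.
Context {R : realType} {n : nat}.
Variables (c H b m2 beta p mu Rad : R) (v0 v1 : 'rV[R]_n -> R).
Hypotheses (c_gt0 : 0 < c) (H_gt0 : 0 < H)
  (bm : 4 * m2 <= b ^+ 2) (beta_ge0 : 0 <= beta) (p_gt1 : 1 < p) (mu_gt0 : 0 < mu)
  (Rad_gt0 : 0 < Rad) (v0L : L1loc v0) (v1L : L1loc v1)
  (v0r : ess_supp v0 `<=` eball Rad) (v1r : ess_supp v1 `<=` eball Rad)
  (v0_gt0 : 0 < mass v0) (v1_gt0 : 0 < mass v1).

Let d := Num.sqrt (b ^+ 2 - 4 * m2).
Let a := (b - d) / 2.
Let q := (beta + 1) * p.
Let Gamma := Gamma_crit n H b m2 beta p mu.
Let cone s := (2 * (Rad + c / H) * expR (H * s)) ^+ n.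
Let I0 := Num.min (mass v0) (mass v1).

(** [k0] is the fundamental solution after removal of the decay [e ^ (- a s)], and
    [w] the growth of the homogeneous solutions that remains: [w = 1] if the
    characteristic roots differ and [w s = 1 + s] for a double root. *)
Variables (k0 w : R -> R).
Hypotheses
  (dk0 : forall s : R, is_derive s 1 k0 (expR (- d * s)))
  (k0_0 : k0 0 = 0)
  (k0_conserved : forall s, expR (- d * s) + d * k0 s = 1)
  (k0_el : forall t, elementary (fun z : R * 'rV[R]_n => k0 (t - z.1)))
  (k0_ge0 : forall s, 0 <= s -> 0 <= k0 s)
  (w_gt0 : forall s, 0 <= s -> 0 < w s)
  (w_data : forall s, 0 <= s -> I0 * w s <= k0 s * mass v1 + (1 + a * k0 s) * mass v0)
  (w_balance : forall s, 0 <= s ->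
     w s `^ q * (1 + s) `^ kappa_crit b m2 beta p = (1 + s)^-1)
  (k0_w : forall s t delta, 0 <= s -> 0 < delta -> delta <= 1 ->
     1 + s <= (1 + t) * expR (- delta) -> delta / (2 + d) * w t <= k0 (t - s)).

Let d_ge0 : 0 <= d. Proof. exact: sqrtr_ge0. Qed.

Let d_sqr : d ^+ 2 = b ^+ 2 - 4 * m2.
Proof. by rewrite sqr_sqrtr// subr_ge0. Qed.

Let q_gt1 : 1 < q.
Proof. by rewrite /q (lt_le_trans p_gt1)// ler_peMl ?lerDr// ltW// (lt_trans ltr01). Qed.

Let Gamma_ge0 s : 0 <= s -> 0 <= Gamma s.
Proof. by move=> _; rewrite !mulr_ge0 ?expR_ge0 ?powR_ge0// ltW. Qed.

Let k s := expR (- a * s) * k0 s.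
Let k1 s := expR (- a * s) * (expR (- d * s) - a * k0 s).
Let k2 s := expR (- a * s) * (a ^+ 2 * k0 s - (d + 2 * a) * expR (- d * s)).

Let dexp (e s : R) : is_derive s 1 (fun s => expR (- e * s)) (- e * expR (- e * s)).
Proof.
have dl : is_derive s 1 (fun s : R => - e * s) (- e).
  have /is_derive_eq := is_deriveZ (- e) (is_derive_id s (1 : R)).
  by apply; exact: mulr1.
have := @is_derive1_comp R expR (fun s => - e * s) s _ _ (is_derive_expR _) dl.
by move=> /is_derive_eq; apply; rewrite mulrC.
Qed.

Let dk (s : R) : is_derive s 1 k (k1 s).
Proof.
have /is_derive_eq := is_deriveM (dexp a s) (dk0 s); apply.
by rewrite /k1 /GRing.scale/=; ring.
Qed.

Let dk1 (s : R) : is_derive s 1 k1 (k2 s).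
Proof.
have := is_deriveM (dexp a s) (is_deriveB (dexp d s) (is_deriveZ a (dk0 s))).
move=> /is_derive_eq; apply.
by rewrite /k2 /GRing.scale/= -[(_ - _) s]/(expR (- d * s) - a * k0 s); ring.
Qed.

Let k_ode s : k2 s + b * k1 s + m2 * k s = 0.
Proof.
have bE : b = 2 * a + d by rewrite /a; field.
have mE : m2 = a * (a + d).
  have : 4 * m2 = b ^+ 2 - d ^+ 2 by rewrite d_sqr; ring.
  by rewrite bE => h; apply: (mulfI (_ : 4 != 0 :> R)); rewrite ?h ?pnatr_eq0//; ring.
rewrite mE bE /k2 /k1 /k; ring.
Qed.

Let k_data s : b * k s + k1 s = expR (- a * s) * (1 + a * k0 s).
Proof.
have bE : b = 2 * a + d by rewrite /a; field.
rewrite -(k0_conserved s) bE /k1 /k; ring.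
Qed.

Let k_el t : elementary (fun z : R * 'rV[R]_n => k (t - z.1)).
Proof.
apply: elementary_mul => //; apply: elementary_exp.
rewrite (_ : (fun z => _) = fun z : R * 'rV[R]_n => a * z.1 + (- a * t)).
  exact: elementary_affine (elementary_time n).
by apply/funext => z; ring.
Qed.

Variables (eps : R) (T : \bar R) (v : R -> 'rV[R]_n -> R).
Hypothesis eps_gt0 : 0 < eps.
Hypothesis sol : weak_solution c H b m2 beta p Gamma eps Rad v0 v1 T v.

Let alive t := 0 < t /\ (t%:E < T)%E.
Let Y t := expR (a * t) * mass (v t) / w t.

Let source t s : \bar R := (if (0 < s)%R then
  (Gamma s * k (t - s))%:E * cone_power c H p Rad v s `^ beta *
    cone_power c H p Rad v s else 0)%E.

Let I0_gt0 : 0 < I0. Proof. by rewrite /I0 lt_min v0_gt0. Qed.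

Let source_ge0 t s : s <= t -> (0 <= source t s)%E.
Proof.
move=> st; rewrite /source; case: ifPn => // s0.
rewrite !mule_ge0 ?poweR_ge0//.
  by rewrite lee_fin mulr_ge0 ?Gamma_ge0 ?(ltW s0)// mulr_ge0 ?expR_ge0// k0_ge0// subr_ge0.
by apply: integral_ge0 => x _; rewrite lee_fin powR_ge0.
Qed.

Let duhamel t : alive t ->
  ((eps * I0 * (expR (- a * t) * w t))%:E +
    \int[lebesgue_measure]_(s in `[0%R, t]) source t s <= (mass (v t))%:E)%E.
Proof.
move=> [t0 tT].
have kge0 s : 0 <= s -> 0 <= k s by move=> s0; rewrite mulr_ge0 ?expR_ge0 ?k0_ge0.
have k_0 : k 0 = 0 by rewrite /k k0_0 mulr0.
have k1_0 : k1 0 = 1 by rewrite /k1 k0_0 !mulr0 expR0 subr0 mulr1.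
have := duhamel_mass n c H b m2 beta p Rad eps Gamma v0 v1 T v k k1 k2 t c_gt0 H_gt0
  Rad_gt0 beta_ge0 v0L v1L v0r v1r Gamma_ge0 kge0 k_0 k1_0 dk dk1 k_ode (k_el t) sol t0 tT.
apply: le_trans; rewrite leeD2r// lee_fin k_data /k.
rewrite -mulrA ler_pM2l// [leLHS]mulrCA.
rewrite [leRHS](_ : _ = expR (- a * t) * (k0 t * mass v1 + (1 + a * k0 t) * mass v0)).
  by rewrite ler_pM2l ?expR_gt0// w_data// ltW.
by ring.
Qed.

Let Y_lower t B : alive t -> B * (expR (- a * t) * w t) <= mass (v t) -> B <= Y t.
Proof.
move=> [t0 _] h; rewrite /Y ler_pdivlMr ?w_gt0 ?(ltW t0)//.
rewrite -(ler_pM2l (expR_gt0 (- a * t))) [leRHS]mulrA -expRD mulNr addNr expR0 mul1r.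
by rewrite -mulNr mulrCA.
Qed.

Let Y_upper t M : alive t -> M <= Y t -> expR (- a * t) * w t * M <= mass (v t).
Proof.
move=> [t0 _]; rewrite /Y ler_pdivlMr ?w_gt0 ?(ltW t0)// => h.
rewrite -mulrA -(ler_pM2l (expR_gt0 (a * t))) [leLHS]mulrA -expRD mulNr addrN expR0 mul1r.
by rewrite mulrC.
Qed.

Let Y_initial t : alive t -> eps * I0 <= Y t.
Proof.
move=> ta; apply: Y_lower => //; rewrite -lee_fin.
apply: le_trans (duhamel _ ta); rewrite leeDl// integral_ge0// => s /=.
by rewrite in_itv/= => /andP[_ /source_ge0].
Qed.

Let source_lower t s M : alive t -> 0 < s -> s <= t -> 0 < M -> M <= Y s ->
  ((profile_constant n c H beta p mu Rad * M `^ q * expR (- a * t) * (1 + s)^-1 *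
     k0 (t - s))%:E <= source t s)%E.
Proof.
move=> [t0 tT] s0 st M0 MY.
have sT : (s%:E < T)%E by apply: le_lt_trans tT; rewrite lee_fin.
have [dv [C1 _ supp _]] := sol; have [vL _ _] := C1 s (ltW s0) sT.
pose X := expR (- a * s) * w s * M.
have X0 : 0 < X by rewrite !mulr_gt0 ?expR_gt0// w_gt0// ltW.
have XV : X <= mass (v s) by exact: Y_upper.
have D0 : 0 < 2 * (Rad + c / H) by rewrite mulr_gt0// addr_gt0// divr_gt0.
have V0 : 0 < cone s by rewrite exprn_gt0// mulr_gt0// expR_gt0.
pose Q := X / 2 * (X / (2 * cone s)) `^ (p - 1).
have Q0 : 0 <= Q by rewrite mulr_ge0 ?powR_ge0// divr_ge0// ltW.
have QP : (Q%:E <= cone_power c H p Rad v s)%E.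
  have r0 : 0 <= Rad + light_cone c H s.
    by rewrite addr_ge0 ?light_cone_ge0// ltW.
  apply: le_trans (power_integral_lower_bound _ _ vL r0 (supp _ s0 sT) _ _ p_gt1
    (lt_le_trans X0 XV) V0 (lebesgue_cone n _ _ _ _ c_gt0 H_gt0 Rad_gt0 (ltW s0))).
  by rewrite lee_fin ler_powR_profile.
have P0 : (0 <= cone_power c H p Rad v s)%E by exact: le_trans QP.
rewrite /source s0 -(critical_balance n c H b m2 beta p mu Rad s t (w s))//; [|exact: ltW..|
  exact: w_gt0 (ltW s0)|exact: w_balance (ltW s0)].
rewrite -/d -/a -/X -/(cone s) -/Q -/Gamma -/(k (t - s)) EFinM -muleA lee_wpmul2l//.
  by rewrite lee_fin mulr_ge0 ?Gamma_ge0 ?(ltW s0)// mulr_ge0 ?expR_ge0// k0_ge0// subr_ge0.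
rewrite EFinM lee_pmul ?lee_fin ?powR_ge0// -poweR_EFin.
by apply: gt0_ler_poweR => //; rewrite in_itv/= ?lee_fin leey andbT.
Qed.

Let Y_step x delta M t : 0 <= x -> 0 < delta -> delta <= 1 -> 0 < M ->
  (forall s, alive s -> x <= ln (1 + s) -> M <= Y s) ->
  alive t -> x + delta <= ln (1 + t) ->
  profile_constant n c H beta p mu Rad / (2 + d) * delta * M `^ q *
    (ln (1 + t) - delta - x) <= Y t.
Proof.
move=> x0 delta0 delta1 M0 hM ta xt.
have [t0 tT] := ta.
have t1 : 0 < 1 + t by rewrite ltr_pwDl// ltW.
(* Only the source in the window [1 + s] between [e ^ x] and [(1 + t) e ^ (- delta)]
   is kept: there [Y] exceeds [M] and the kernel is not yet degenerate. *)
pose A := expR x - 1; pose B := (1 + t) * expR (- delta) - 1.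
have A1 : 1 + A = expR x by rewrite /A; ring.
have B1 : 1 + B = (1 + t) * expR (- delta) by rewrite /B; ring.
have lnB : ln (1 + B) = ln (1 + t) - delta.
  by rewrite B1 lnM ?posrE ?expR_gt0// expRK.
have lnA : ln (1 + A) = x by rewrite A1 expRK.
have A0 : 0 <= A by rewrite subr_ge0 -expR0 ler_expR.
have Bt : B <= t.
  rewrite /B lerBlDl ler_piMr ?(ltW t1)//.
  by rewrite -expR0 ler_expR oppr_le0 ltW.
move: xt; rewrite le_eqVlt => /predU1P[<-|xt].
  rewrite addrK subrr mulr0 (le_trans _ (Y_initial _ ta))//.
  by rewrite mulr_ge0 ?(ltW eps_gt0) ?(ltW I0_gt0).
have AB : A < B.
  rewrite -(ltrD2l 1) -ltr_ln ?posrE ?A1 ?B1 ?mulr_gt0 ?expR_gt0//.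
  by rewrite -A1 -B1 lnA lnB ltrBrDr.
have d2 : 0 < 2 + d by rewrite ltr_pwDl.
pose P := profile_constant n c H beta p mu Rad.
have P0 : 0 < P by rewrite mulr_gt0 ?expR_gt0.
pose C := P * M `^ q * expR (- a * t) * (delta / (2 + d) * w t).
have w0 : 0 <= w t by rewrite ltW// w_gt0// ltW.
have C0 : 0 <= C.
  apply: mulr_ge0; last by rewrite mulr_ge0// divr_ge0 ?ltW.
  by apply: mulr_ge0; rewrite ?expR_ge0// mulr_ge0 ?powR_ge0// ltW.
have low : (\int[lebesgue_measure]_(s in `]A, B]) (C * (1 + s)^-1)%:E <=
    \int[lebesgue_measure]_(s in `[0%R, t]) source t s)%E.
  have -> : `]A, B]%classic = `[0, t]%classic `&` `]A, B]%classic :> set R.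
    apply/seteqP; split => [s|s []//]; rewrite /= !in_itv/= => /andP[As sB].
    by rewrite As sB (le_trans sB Bt) (le_trans A0 (ltW As)).
  rewrite integral_mkcondr; apply: ge0_le_lower_integral => s /=; rewrite in_itv/= => /andP[s0 st].
    apply: erestrict_ge0 => y /=; rewrite in_itv/= => /andP[Ay _].
    by rewrite lee_fin mulr_ge0// invr_ge0 addr_ge0// (le_trans A0)// ltW.
  rewrite /patch; case: ifPn => [|_]; last exact: source_ge0.
  rewrite inE/= in_itv/= => /andP[As sB].
  have s0' : 0 < s by exact: le_lt_trans As.
  have s1 : 0 < 1 + s by rewrite ltr_pwDl.
  have sa : alive s by split => //; apply: le_lt_trans tT; rewrite lee_fin.
  have MY : M <= Y s.
    apply: hM => //; rewrite -[x]expRK ler_ln ?posrE ?expR_gt0//.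
    by rewrite -A1 lerD2l ltW.
  apply: le_trans (source_lower t s M ta s0' st M0 MY); rewrite lee_fin /C -/P.
  rewrite [leLHS]mulrAC ler_wpM2l//.
    apply: mulr_ge0; last by rewrite invr_ge0 ltW.
    by apply: mulr_ge0; rewrite ?expR_ge0// mulr_ge0 ?powR_ge0// ltW.
  by apply: k0_w => //; rewrite -B1 lerD2l.
apply: Y_lower => //; rewrite -lee_fin.
apply: le_trans (duhamel _ ta); rewrite (le_trans _ (leeDr _ _))//; last first.
  by rewrite lee_fin !mulr_ge0 ?expR_ge0 ?(ltW eps_gt0) ?(ltW I0_gt0).
apply: le_trans low; rewrite integral_inv1D// lnA lnB lee_fin /C -/P.
by rewrite le_eqVlt; apply/orP; left; apply/eqP; field; rewrite gt_eqF.
Qed.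

(** The iteration applies to [Y]: [Y_initial] starts it and [Y_step] is the gain of
    one round. *)
Lemma critical_log_time t : alive t ->
  ln (1 + t) <= 2 * (1 + (2 + 4 `^ (q - 1)^-1) /
    (profile_constant n c H beta p mu Rad / (2 + d)) * (eps * I0) `^ (1 - q)).
Proof.
apply: (log_time_bound q _ _ alive Y) => //.
- by rewrite !mulr_gt0 ?expR_gt0// invr_gt0 ltr_pwDl.
- exact: mulr_gt0.
Qed.

End critical.

(** A gap [delta] in logarithmic time is a gap of order [delta (1 + t)] in time. *)
Lemma log_gap {R : realType} (s t delta : R) : 0 <= s -> 0 < delta -> delta <= 1 ->
  1 + s <= (1 + t) * expR (- delta) -> 1 <= 1 + t /\ delta / 2 * (1 + t) <= t - s.
Proof.
move=> s0 d0 d1 st.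
have eN : expR (- delta) <= 1 - delta / 2.
  have e1 : 1 + delta <= expR delta by exact: expR_ge1Dx.
  rewrite expRN -[leLHS]div1r ler_pdivrMr ?expR_gt0//.
  by nra.
have t1 : 0 < 1 + t.
  rewrite ltNge; apply/negP => t0; have := expR_gt0 (- delta) => e0; nra.
split; last by nra.
by have := expR_gt0 (- delta); nra.
Qed.

(** Both kinds of characteristic roots are treated alike from these properties on.
    The fundamental solution is [(1 - e ^ (- d s)) / d] with [w = 1] for distinct
    roots, and [s] with [w s = 1 + s] for a double root; in the latter case the factor
    [(1 + t) ^ (- q)] in the critical coefficient offsets the growth of [w ^ q]. *)
Lemma fundamental_profile {R : realType} (n : nat) (d a q kap V0 V1 : R) :
  0 <= d -> 0 <= a -> 0 < V0 -> 0 < V1 ->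
  kap = (if 0 < d then - 1 else - 1 - q) ->
  exists k0 w : R -> R,
  ([/\ (forall s : R, is_derive s 1 k0 (expR (- d * s))), k0 0 = 0,
      forall s, expR (- d * s) + d * k0 s = 1,
      forall t, elementary (fun z : R * 'rV[R]_n => k0 (t - z.1)) &
      forall s, 0 <= s -> 0 <= k0 s] /\
   [/\ forall s, 0 <= s -> 0 < w s,
      forall s, 0 <= s -> Num.min V0 V1 * w s <= k0 s * V1 + (1 + a * k0 s) * V0,
      forall s, 0 <= s -> w s `^ q * (1 + s) `^ kap = (1 + s)^-1 &
      forall s t delta, 0 <= s -> 0 < delta -> delta <= 1 ->
        1 + s <= (1 + t) * expR (- delta) -> delta / (2 + d) * w t <= k0 (t - s)]).
Proof.
move=> d0 a0 V00 V10; case: ifPn => [d_gt0|d_le0] kapE.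
  have dn0 : d != 0 by rewrite gt_eqF.
  have k_ge0 s : 0 <= s -> 0 <= (1 - expR (- d * s)) / d.
    move=> s0; rewrite divr_ge0// subr_ge0 -expR0 ler_expR.
    by rewrite mulNr oppr_le0 mulr_ge0.
  exists (fun s => (1 - expR (- d * s)) / d), (fun=> 1); split; split => //.
  - move=> s.
    have dl : is_derive s 1 (fun s : R => - d * s) (- d).
      have /is_derive_eq := is_deriveZ (- d) (is_derive_id s (1 : R)).
      by apply; exact: mulr1.
    have de := @is_derive1_comp R expR (fun s => - d * s) s _ _ (is_derive_expR _) dl.
    have -> : (fun s => (1 - expR (- d * s)) / d) =
        d^-1 \*: (cst 1 - (expR \o (fun s => - d * s))).
      by apply/funext => y; rewrite /GRing.scale/= mulrC.
    have /is_derive_eq := is_deriveZ d^-1 (is_deriveB (is_derive_cst (1 : R) s 1) de).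
    by apply; rewrite /GRing.scale/=; field.
  - by rewrite mulr0 expR0 subrr mul0r.
  - by move=> s; field.
  - move=> t; rewrite (_ : (fun z => _) = fun z : R * 'rV[R]_n =>
      - d^-1 * expR (d * z.1 + (- d * t)) + d^-1).
      apply: elementary_affine; apply: elementary_exp.
      exact: elementary_affine (elementary_time n).
    apply/funext => z; rewrite (_ : - d * (t - z.1) = d * z.1 + (- d * t)); last by ring.
    by field.
  - move=> s s0; rewrite mulr1; apply: (@le_trans _ _ V0); first by rewrite ge_min lexx.
    move: ((1 - expR (- d * s)) / d) (k_ge0 s s0) => K K0.
    by rewrite mulrDl mul1r addrCA lerDl addr_ge0 ?mulr_ge0 ?(ltW V00) ?(ltW V10).
  - by move=> s s0; rewrite kapE powR1 mul1r powR_inv1 ?addr_ge0.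
  - move=> s t delta s0 de0 de1 st; have [t1 ts] := log_gap s t delta s0 de0 de1 st.
    have y0 : 0 < 1 + d * (delta / 2) by rewrite ltr_pwDl// mulr_ge0// divr_ge0 ?ltW.
    have e1 : expR (- d * (t - s)) <= (1 + d * (delta / 2))^-1.
      rewrite mulNr expRN lef_pV2 ?posrE ?expR_gt0//.
      apply: le_trans (expR_ge1Dx _); rewrite lerD2l ler_wpM2l//.
      by apply: le_trans ts; rewrite ler_peMr// divr_ge0// ltW.
    rewrite mulr1 ler_pdivlMr//; apply: (@le_trans _ _ (1 - (1 + d * (delta / 2))^-1)).
      have -> : 1 - (1 + d * (delta / 2))^-1 = delta * d / (2 + d * delta).
        by field; rewrite ?gt_eqF// ltr_pwDl// mulr_ge0 ?ltW.
      rewrite mulrAC ler_wpM2l ?mulr_ge0 ?(ltW de0)//.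
      rewrite lef_pV2 ?posrE ?ltr_pwDl ?mulr_ge0 ?(ltW de0)//.
      by rewrite lerD2l ler_piMr.
    by rewrite lerD2l lerN2.
have {d_le0}-> : d = 0 by apply/eqP; rewrite eq_le d0 andbT leNgt.
exists id, (fun s => 1 + s); split; split => //.
- by move=> s; rewrite oppr0 mul0r expR0; exact: is_derive_id.
- by move=> s; rewrite oppr0 !mul0r expR0 addr0.
- move=> t; rewrite (_ : (fun z => _) = fun z : R * 'rV[R]_n => -1 * z.1 + t).
    exact: elementary_affine (elementary_time n).
  by apply/funext => z; ring.
- by move=> s s0; rewrite ltr_pwDl.
- move=> s s0; have mV0 : Num.min V0 V1 <= V0 by rewrite ge_min lexx.
  have mV1 : Num.min V0 V1 <= V1 by rewrite ge_min lexx orbT.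
  have as0 : 0 <= a * s * V0 by rewrite !mulr_ge0// ltW.
  by nra.
- move=> s s0; have s1 : 0 < 1 + s by rewrite ltr_pwDl.
  rewrite kapE -powRD; last by rewrite (gt_eqF s1) implybT.
  by rewrite (_ : q + (-1 - q) = -1) ?powR_inv1 ?(ltW s1)//; ring.
- move=> s t delta s0 de0 de1 st; have [_ ts] := log_gap s t delta s0 de0 de1 st.
  by rewrite addr0.
Qed.

Theorem theorem1p8 (R : realType) (n : nat) (c H b m2 beta p mu Rad : R)
    (v0 v1 : 'rV[R]_n -> R)
    (hn : (1 <= n)%N) (hc : 0 < c) (hH : 0 < H) (hb : 0 <= b) (hm2 : 0 <= m2)
    (hbm : 4 * m2 <= b ^+ 2) (hbeta : 0 <= beta) (hp : 1 < p)
    (hcond : n%:R / 2 - Num.sqrt (b ^+ 2 - 4 * m2) / (2 * H) <= 1 / p)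
    (hmu : 0 < mu) (hRad : 0 < Rad)
    (hv0 : L1loc v0) (hv1 : L1loc v1)
    (hv0_ge0 : {ae @lebesgue_rV R n, forall x, 0 <= v0 x})
    (hv1_ge0 : {ae @lebesgue_rV R n, forall x, 0 <= v1 x})
    (hv0_neq0 : ~ {ae @lebesgue_rV R n, forall x, v0 x = 0})
    (hv1_neq0 : ~ {ae @lebesgue_rV R n, forall x, v1 x = 0})
    (hv0_supp : ess_supp v0 `<=` eball Rad)
    (hv1_supp : ess_supp v1 `<=` eball Rad) :
  let Gamma := Gamma_crit n H b m2 beta p mu in
  exists eps0 C K : R, [/\ 0 < eps0, 0 < C, 0 < K &
    forall eps : R, 0 < eps -> eps <= eps0 ->
    forall (T : \bar R) (v : R -> 'rV[R]_n -> R), (0 < T)%E ->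
      weak_solution c H b m2 beta p Gamma eps Rad v0 v1 T v ->
      let Teps := lifespan c H b m2 beta p Gamma eps Rad v0 v1 T v in
      (Teps < +oo)%E /\
      (Teps <= (C * expR (K * eps `^ (- ((beta + 1) * p - 1))))%:E)%E].
Proof.
move=> Gamma.
have V00 := mass_gt0 n v0 Rad hv0 (ltW hRad) hv0_supp hv0_ge0 hv0_neq0.
have V10 := mass_gt0 n v1 Rad hv1 (ltW hRad) hv1_supp hv1_ge0 hv1_neq0.
pose d := Num.sqrt (b ^+ 2 - 4 * m2); pose a := (b - d) / 2; pose q := (beta + 1) * p.
have d0 : 0 <= d by exact: sqrtr_ge0.
have a0 : 0 <= a.
  rewrite divr_ge0// subr_ge0 -(ler_pXn2r (n := 2))// sqr_sqrtr ?subr_ge0//.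
  by rewrite lerBlDr lerDl mulr_ge0.
have kapE : kappa_crit b m2 beta p = (if 0 < d then - 1 else - 1 - q).
  by rewrite /kappa_crit /d sqrtr_gt0 subr_gt0.
have [k0 [w [[k1 k2 k3 k4 k5] [w1 w2 w3 w4]]]] :=
  fundamental_profile n d a q _ _ _ d0 a0 V00 V10 kapE.
pose I0 := Num.min (mass v0) (mass v1).
have I00 : 0 < I0 by rewrite lt_min V00.
pose G := (2 + 4 `^ (q - 1)^-1) / (profile_constant n c H beta p mu Rad / (2 + d)) *
  I0 `^ (1 - q).
have G0 : 0 < G.
  rewrite mulr_gt0 ?powR_gt0// divr_gt0 ?ltr_pwDl ?powR_ge0//.
  by rewrite divr_gt0 ?mulr_gt0 ?expR_gt0// ltr_pwDl.
exists 1, (expR 2), (2 * G); split; [exact: ltr01|exact: expR_gt0|exact: mulr_gt0|].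
move=> eps eps0 _ T v T0 sol Teps.
(* Every extension of [v] is itself a weak solution, so bounding the existence
   time of all weak solutions bounds the lifespan. *)
suff bound : (Teps <= (expR 2 * expR (2 * G * eps `^ (- (q - 1))))%:E)%E.
  by split => //; apply: le_lt_trans bound _; rewrite ltry.
apply: ge_ereal_sup => T' [TT' [u [usol _]]].
rewrite leNgt; apply/negP => /lt_EFin_between[t tE tT'].
have t0 : 0 < t by apply: lt_trans tE; rewrite mulr_gt0 ?expR_gt0.
have := critical_log_time c H b m2 beta p mu Rad v0 v1 hc hH hbm hbeta hp hmu hRad
  hv0 hv1 hv0_supp hv1_supp V00 V10 k0 w k1 k2 k3 k4 k5 w1 w2 w3 w4 eps T' u eps0 usol t
  (conj t0 tT').
apply/negP; rewrite -ltNge.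
rewrite -ltr_expR lnK ?posrE; last by rewrite ltr_pwDl// ltW.
rewrite -/d -/q -/I0 powRM ?(ltW eps0) ?(ltW I00)//.
apply: (@lt_trans _ _ t); last by rewrite ltrDr.
rewrite (_ : expR _ = expR 2 * expR (2 * G * eps `^ (- (q - 1))))//.
by rewrite -expRD opprB /G; congr expR; ring.
Qed.
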